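(* Suppose the convexity assumption stated in the context holds (together with the standing assumptions there). Let $x_{k+1}=\Pi_{\mathcal B}(x_k-\eta_kH_k)$, $k\ge1$, with step sizes $\eta_k\to0$, and suppose there exists a constant $K_3\ge1$ such that the following conditions hold for all $k\ge1$, where $0<\beta\le1$ is a constant: (a) $\left(1+\frac1k\right)^\beta\le1+\frac{K_0}{2}\eta_k$; (b) $B_k\le\frac{K_0}{8}k^{-\beta}$; (c) $\eta_k\mathcal V_k\le K_3k^{-\beta}$. Then there exists a constant $C\ge 8K_3/K_0$, given explicitly by $$C=\max\left(k_0^{\beta}\left(|\bar\mu-\underline\mu|^2+|\bar p-\underline p|^2\right),\ \frac{8K_3}{K_0}\right),\qquad k_0=\max\{k\ge1:\ 2\eta_kK_0>1\}$$ (with $k_0=1$ if this set is empty), such that for all $k\ge1$, $$\mathbb E[\|x_k-x^*\|^2]\le Ck^{-\beta},$$ and as a consequence $$R_2(L)\le CK_1\sum_{k=1}^L\left(\frac{D_k}{\lambda(\bar p)}+M\right)k^{-\beta}=O\left(\sum_{k=1}^LD_kk^{-\beta}\right).$$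
   Context: **Model.** Fix $0<\underline\mu<\bar\mu$, $0<\underline p<\bar p$, $\mathcal B=[\underline\mu,\bar\mu]\times[\underline p,\bar p]$, a demand function $\lambda:[\underline p,\bar p]\to(0,\infty)$, a staffing cost function $c$ on $[\underline\mu,\bar\mu]$, and a holding cost $h_0>0$. Let $U_1,U_2,\dots$ and $V_1,V_2,\dots$ be two independent i.i.d. sequences of nonnegative random variables with unit means. The $GI/GI/1$ (FIFO) queue with parameter $(\mu,p)$ has interarrival times $U_n/\lambda(p)$ and service times $V_n/\mu$, with waiting times $W_n=(W_{n-1}+V_n/\mu-U_n/\lambda(p))^+$; $W_\infty(\mu,p)$ is its steady-state waiting time. The objective to be minimized over $\mathcal B$ is $f(\mu,p)=h_0\lambda(p)(\mathbb E[W_\infty(\mu,p)]+\frac1\mu)+c(\mu)-p\lambda(p)$. Write $x=(\mu,p)$; $x^*=(\mu^*,p^* )$ is the minimizer of $f$ over $\mathcal B$; $\|\cdot\|$ is the Euclidean norm. **Standing assumptions.** (Stability) $\lambda$ is continuously differentiable and non-increasing; $c$ is continuously differentiable and non-decreasing; $\lambda(\underline p)<\underline\mu$. (Light tails) There is a sufficiently small constant $\eta>0$ with $\mathbb E[e^{\eta V_n}]<\infty$, $\mathbb E[e^{\eta U_n}]<\infty$, and there are constants $0<\theta<\eta/(2\bar\mu)$, $0<a<(\underline\mu-\lambda(\underline p))/(\underline\mu+\lambda(\underline p))$ and $\gamma>0$ with $\phi_U(-\theta)<-(1-a)\theta-\gamma$ and $\phi_V(\theta)<(1+a)\theta-\gamma$,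 where $\phi_V(\theta)=\log\mathbb E[e^{\theta V_n}]$, $\phi_U(\theta)=\log\mathbb E[e^{\theta U_n}]$. **Convexity assumption.** There are finite constants $0<K_0\le1$ and $K_1>K_0$ such that for all $x\in\mathcal B$: $(x-x^* )^T\nabla f(x)\ge K_0\|x-x^*\|^2$ and $\|\nabla f(x)\|\le K_1\|x-x^*\|$. **Dynamics in cycles.** The queue is operated in cycles $k=1,2,\dots$ with policies $x_k=(\mu_k,p_k)\in\mathcal B$ and deterministic integer cycle lengths $D_k\ge1$, starting empty. Cycle $k$ ends when $D_k$ customers have entered service in it. $H_k$ is a random estimator of $\nabla f(x_k)$ built from data collected up to the end of cycle $k$, $\Pi_{\mathcal B}$ is the Euclidean projection onto $\mathcal B$, and $\mathcal F_k$ is the $\sigma$-algebra of all events in the first $k-1$ cycles, so $x_k$ is $\mathcal F_k$-measurable. Customer $n$ of cycle $k$ ($1\le n\le D_k$) is the $n$th to enter service in cycle $k$; customer $0$ of cycle $k$ is customer $D_{k-1}$ of cycle $k-1$, who enters service at the beginning of cycle $k$. Customer $n-1$ of cycle $k$ has service time $V_n^k/\mu_k$; $U_n^k$ corresponds to the interarrival time between customers $n-1$ and $n$; $(U_n^k),(V_n^k)$ are independent i.i.d. copies of $U,V$. $Q_k$ is the number of customers present at the beginning of cycle $k$, including customer $0$ just entering service ($Q_1=0$, $Q_k\ge1$ for $k\ge2$). The service rate becomes $\mu_k$ at the beginning of cycle $k$; the price becomes $p_k$ only right after the first arrival in cycle $k$ (customer $Q_k$). For $1\le n\le Q_k$ let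 $p_n^k\in\{p_1,\dots,p_{k-1}\}$ be the price in force during the interarrival time preceding customer $n$. With $\ell_n^k=\lambda(p_n^k)$ if $n\le Q_k$ and $\ell_n^k=\lambda(p_k)$ if $n>Q_k$, interarrival times are $U_n^k/\ell_n^k$, and waiting times and observed busy periods are, for $1\le n\le D_k$, $$W_n^k=\Big(W_{n-1}^k+\tfrac{V_n^k}{\mu_k}-\tfrac{U_n^k}{\ell_n^k}\Big)^+,\quad X_n^k=\Big(X_{n-1}^k+\tfrac{U_n^k}{\ell_n^k}\Big)\mathbf 1_{\{W_n^k>0\}},\quad W_0^k=W_{D_{k-1}}^{k-1},\ X_0^k=X_{D_{k-1}}^{k-1},$$ with $W_0^1=X_0^1=0$. $T_k$ is the duration of cycle $k$. **Constant $M$.** $M$ is a finite positive constant such that for any policy sequence in $\mathcal B$ and any $D_k\ge1$, the quantities $\mathbb E[(W_n^k)^m]$, $\mathbb E[(X_n^k)^m]$, $\mathbb E[(Q_k)^m]$, $\mathbb E[e^{\eta W_n^k}]$, $\mathbb E[e^{\eta Q_k}]$ are at most $M$ for all $k\ge1$, $1\le n\le D_k$, $1\le m\le4$ (it exists because $\eta$ is sufficiently small). Note that $\eta$ (without index) is the light-tail constant while $\eta_k$ is the step size. **Bias, variance, regret of suboptimality.** $B_k=\mathbb E\big[\|\mathbb E[H_k-\nabla f(x_k)\mid\mathcal F_k]\|^2\big]^{1/2}$, $\mathcal V_k=\mathbb E[\|H_k\|^2]$, and $R_2(L)=\sum_{k=1}^L\mathbb E\big[T_k\big(f(\mu_k,p_k)-f(\mu^*,p^*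 )\big)\big]$.
   Formalization: In the constant C, k_0 is taken as 1 + max{k≥1: 2η_kK_0>1} when this set is nonempty (still 1 if it is empty), since with the printed k_0 the bound can fail at k = k_0+1. *)

(* Defs.v *)
From HB Require Import structures.
From mathcomp Require Import all_boot all_order all_algebra.
From mathcomp Require Import all_classical all_reals all_analysis.

Set Implicit Arguments.
Unset Strict Implicit.
Unset Printing Implicit Defensive.

Import Order.TTheory GRing.Theory Num.Theory.
Import numFieldNormedType.Exports.

Local Open Scope classical_set_scope.
Local Open Scope ring_scope.

(** Conventions.  A policy is a pair x = (mu, p) : R * R.  Cycles are numbered
    from 1: for a sequence indexed by cycles the value at 0 is irrelevant.  The
    primitive sequences are numbered from 0: [U i] and [V i] stand for U_(i+1)
    and V_(i+1).  Customers are numbered in order of arrival over the whole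
    operation, so that customer n of cycle k is customer [served D k + n],
    U_n^k is [U (served D k + n.-1)] and V_n^k is [V (served D k + n.-1)]; for
    n > D_k, [U (served D k + n.-1)] is still the interarrival time between
    customers n-1 and n counted from the beginning of cycle k. *)

Section Plane.
Context {R : realType}.
Implicit Types x y z : R * R.

Definition dot x y : R := x.1 * y.1 + x.2 * y.2.
Definition enorm x : R := Num.sqrt (dot x x).

Definition is_proj (B : set (R * R)) y z :=
  B z /\ forall z', B z' -> enorm (y - z) <= enorm (y - z').

(** The gradient is taken relative to B, i.e. one-sided at its boundary; it is
    unique when B is a nondegenerate rectangle. *)
Definition gradient_on (B : set (R * R)) (f : R * R -> R)
    (g : R * R -> R * R) :=
  forall x, B x -> forall e : R, 0 < e -> exists2 r : R, 0 < r &
    forall y, B y -> enorm (y - x) < r ->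
      `|f y - f x - dot (g x) (y - x)| <= e * enorm (y - x).

Definition is_minimizer (B : set (R * R)) (f : R * R -> R) xs :=
  B xs /\ forall x, B x -> f xs <= f x.

Definition convexity (B : set (R * R)) (g : R * R -> R * R) xs (K0 K1 : R) :=
  [/\ 0 < K0 <= 1, K0 < K1 &
    forall x, B x -> K0 * enorm (x - xs) ^+ 2 <= dot (x - xs) (g x) /\
                     enorm (g x) <= K1 * enorm (x - xs)].

(** Continuous differentiability on a closed interval, one-sided at the
    endpoints. *)
Definition C1_on (a b : R) (f : R -> R) :=
  exists2 f' : R -> R, {within `[a, b], continuous f'} &
    forall t, t \in `[a, b] ->
      (f s - f t) / (s - t) @[s --> within [set` `[a, b]] t^'] --> f' t.

End Plane.

Record queue_model (R : realType) := QueueModel {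
  mu_lo : R; mu_hi : R; p_lo : R; p_hi : R;
  lam : R -> R;   (* demand as a function of the price *)
  cost : R -> R;  (* staffing cost as a function of the service rate *)
  h0 : R          (* holding cost *) }.

Section Model.
Context {R : realType} (Q : queue_model R).

Definition box : set (R * R) :=
  [set x | x.1 \in `[mu_lo Q, mu_hi Q] /\ x.2 \in `[p_lo Q, p_hi Q]].

Definition valid_model :=
  [/\ 0 < mu_lo Q < mu_hi Q, 0 < p_lo Q < p_hi Q, 0 < h0 Q &
      forall p, p \in `[p_lo Q, p_hi Q] -> 0 < lam Q p].

Definition stability :=
  [/\ C1_on (p_lo Q) (p_hi Q) (lam Q),
      {in `[p_lo Q, p_hi Q] &, {homo lam Q : p q / p <= q >-> q <= p}},
      C1_on (mu_lo Q) (mu_hi Q) (cost Q),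
      {in `[mu_lo Q, mu_hi Q] &, {homo cost Q : m n / m <= n}} &
      lam Q (p_lo Q) < mu_lo Q].

End Model.

Section Probability.
Context {d : measure_display} {T : measurableType d} {R : realType}.
Variable P : probability T R.

Definition mutually_independent (I : eqType) (X : I -> T -> R) :=
  forall (J : seq I) (A : I -> set R), uniq J ->
    (forall j, measurable (A j)) ->
    P (\bigcap_(j in [set` J]) (X j @^-1` A j))
    = (\prod_(j <- J) P (X j @^-1` A j))%E.

Definition identically_distributed (X : nat -> T -> R) :=
  forall i (A : set R), measurable A -> P (X i @^-1` A) = P (X 0%N @^-1` A).

(** Mutual independence of the joint family indexed by [nat + nat] says that
    each sequence is independent and that the two sequences are independent of
    each other. *)
Definition primitives (U V : nat -> {RV P >-> R}) :=
  [/\ mutually_independent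
        (fun i : nat + nat => match i with
                              | inl n => U n : T -> R
                              | inr n => V n : T -> R end),
      identically_distributed (fun n => U n : T -> R),
      identically_distributed (fun n => V n : T -> R),
      forall n w, 0 <= U n w /\ 0 <= V n w &
      forall n, ('E_P[U n] = 1 /\ 'E_P[V n] = 1)%E].

Definition log_mgf (X : T -> R) (t : R) : \bar R := lne ('M_P X t).

Definition light_tails (Q : queue_model R) (U V : nat -> {RV P >-> R})
    (eta : R) :=
  [/\ 0 < eta,
      forall n, ('M_P (V n) eta < +oo)%E /\ ('M_P (U n) eta < +oo)%E &
      exists theta a gamma : R,
      [/\ 0 < theta < eta / (2 * mu_hi Q),
          0 < a < (mu_lo Q - lam Q (p_lo Q)) / (mu_lo Q + lam Q (p_lo Q)),
          0 < gamma,
          forall n, (log_mgf (U n) (- theta)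
                     < (- (1 - a) * theta - gamma)%:E)%E &
          forall n, (log_mgf (V n) theta
                     < ((1 + a) * theta - gamma)%:E)%E]].

(** [X] is measurable for the sub-sigma-algebra [F] of [T]. *)
Definition adapted_to d' (S : measurableType d') (F : set (set T))
    (X : T -> S) :=
  preimage_set_system setT X measurable `<=` F.

(** [Y] is a version of E[X | F]. *)
Definition is_cond_exp (F : set (set T)) (X Y : T -> R) :=
  [/\ P.-integrable setT (EFin \o X), P.-integrable setT (EFin \o Y),
      adapted_to F Y &
      forall A, F A -> (\int[P]_(w in A) (Y w)%:E
                        = \int[P]_(w in A) (X w)%:E)%E].

Definition is_cond_exp2 (F : set (set T)) (X Y : T -> R * R) :=
  is_cond_exp F (fun w => (X w).1) (fun w => (Y w).1) /\
  is_cond_exp F (fun w => (X w).2) (fun w => (Y w).2).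

End Probability.

Section Steady.
Context {d : measure_display} {T : measurableType d} {R : realType}.
Variables (P : probability T R) (Q : queue_model R).
Variables (U V : nat -> {RV P >-> R}).

Fixpoint lindley (x : R * R) (n : nat) (w : T) : R :=
  if n is m.+1
  then Num.max 0 (lindley x m w + V m w / x.1 - U m w / lam Q x.2)
  else 0.

(** [Winf x] is the law of the steady-state waiting time W_oo(x): the limit in
    distribution of the waiting times of the GI/GI/1 queue with parameter x. *)
Definition steady_state (Winf : R * R -> probability (measurableTypeR R) R) :=
  forall x, box Q x ->
  forall g : R -> R, continuous g -> (exists b : R, forall t, `|g t| <= b) ->
    'E_P[fun w => g (lindley x n w)]%E @[n --> \oo]
      --> (\int[Winf x]_t (g t)%:E)%E.

Definition objective (Winf : R * R -> probability (measurableTypeR R) R)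
    (x : R * R) : R :=
  h0 Q * lam Q x.2 * (fine (\int[Winf x]_t t%:E)%E + x.1^-1)
  + cost Q x.1 - x.2 * lam Q x.2.

End Steady.

(** S_(k-1): the number of customers who entered service before cycle k,
    the initial customer 0 of cycle 1 excepted. *)
Definition served (D : nat -> nat) (k : nat) : nat := \sum_(1 <= j < k) D j.

(** The dynamics on one sample path: [x] is the policy sequence, [u] and [v] the
    primitive sequences. *)
Section Path.
Context {R : realType}.
Variables (lam : R -> R) (D : nat -> nat) (x : nat -> R * R) (u v : nat -> R).

(** In the next five definitions [prc i] is the price in force during the
    interarrival time [u i], and w0, x0 are W_0^k and X_0^k. *)

Definition arrival_at (prc : nat -> R) (k n : nat) : R :=
  \sum_(i < n) u (served D k + i) / lam (prc (served D k + i)%N).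

(** Cycle k begins when customer 0 has waited w0, so customer n is present
    at that time iff he arrived at most w0 after customer 0.  The value is
    [+oo] on the null event that infinitely many have. *)
Definition head_count (prc : nat -> R) (k : nat) (w0 : R) : \bar R :=
  if k == 1%N then 0%E
  else (\sum_(0 <= n <oo) ((arrival_at prc k n <= w0)%R%:R)%:E)%E.

Fixpoint wait_at (prc : nat -> R) (k : nat) (w0 : R) (n : nat) : R :=
  if n is m.+1
  then let i := (served D k + m)%N in
       Num.max 0 (wait_at prc k w0 m + v i / (x k).1 - u i / lam (prc i))
  else w0.

Fixpoint busy_at (prc : nat -> R) (k : nat) (w0 x0 : R) (n : nat) : R :=
  if n is m.+1
  then let i := (served D k + m)%N in
       (busy_at prc k w0 x0 m + u i / lam (prc i))
       * (0 < wait_at prc k w0 n)%R%:R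
  else x0.

(** Prices after the decisions of cycles 1, ..., k-1 become [p_k] from the
    interarrival time following customer Q_k of cycle k on; [u i] precedes
    customer [i.+1 - served D k] of cycle k. *)
Definition reprice (prc : nat -> R) (k : nat) (w0 : R) (i : nat) : R :=
  if ((i.+1 - served D k)%:R%:E <= head_count prc k w0)%E then prc i
  else (x k).2.

(** The prices resulting from the decisions of cycles 1, ..., k, together with
    the waiting time and observed busy period of the last customer of cycle k.
    The initial constant price is never used, as Q_1 = 0. *)
Fixpoint cycle_end (k : nat) : (nat -> R) * R * R :=
  if k is j.+1 then
    let: (prc, w0, x0) := cycle_end j in
    let prc' := reprice prc k w0 in
    (prc', wait_at prc' k w0 (D k), busy_at prc' k w0 x0 (D k))
  else (fun=> (x 1%N).2, 0, 0).

Definition prices (k : nat) : nat -> R := (cycle_end k).1.1.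
Definition W0 (k : nat) : R := (cycle_end k.-1).1.2.
Definition X0 (k : nat) : R := (cycle_end k.-1).2.

Definition queue_length (k : nat) : \bar R :=
  head_count (prices k.-1) k (W0 k).
Definition waiting (k n : nat) : R := wait_at (prices k) k (W0 k) n.
Definition busy (k n : nat) : R := busy_at (prices k) k (W0 k) (X0 k) n.

(** Time at which customer n of cycle k enters service, counted from the
    arrival of customer 0 of cycle k. *)
Definition entry (k n : nat) : R := arrival_at (prices k) k n + waiting k n.

Definition duration (k : nat) : R := entry k (D k) - entry k 0.

End Path.

Section Cycles.
Context {d : measure_display} {T : measurableType d} {R : realType}.
Variables (P : probability T R) (Q : queue_model R).
Variables (U V : nat -> {RV P >-> R}).

(** F_k, generated by the interarrival and service times U_n^j, V_n^j with
    1 <= n <= D_j and j < k. *)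
Definition history (D : nat -> nat) (k : nat) : set (set T) :=
  <<s \bigcup_(i in [set i | (i < served D k)%N])
        (preimage_set_system setT (U i : T -> R) measurable `|`
         preimage_set_system setT (V i : T -> R) measurable) >>.

Definition is_policy (D : nat -> nat) (x : nat -> T -> R * R) :=
  forall k, (1 <= k)%N ->
    (forall w, box Q (x k w)) /\ adapted_to (history D k) (x k).

Definition on_path (A : Type)
    (q : (R -> R) -> (nat -> nat) -> (nat -> R * R) -> (nat -> R) ->
         (nat -> R) -> A)
    (D : nat -> nat) (x : nat -> T -> R * R) (w : T) : A :=
  q (lam Q) D (fun k => x k w) (fun i => U i w) (fun i => V i w).

Definition rwaiting D x k n (w : T) : R := on_path (@waiting R) D x w k n.
Definition rbusy D x k n (w : T) : R := on_path (@busy R) D x w k n.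
Definition rqueue D x k (w : T) : \bar R := on_path (@queue_length R) D x w k.
Definition rduration D x k (w : T) : R := on_path (@duration R) D x w k.

Definition moment_bound (eta M : R) :=
  0 < M /\
  forall (D : nat -> nat) (x : nat -> T -> R * R),
    (forall k, (1 <= k)%N -> (1 <= D k)%N) -> is_policy D x ->
  forall k n m : nat, (1 <= k)%N -> (1 <= n <= D k)%N -> (1 <= m <= 4)%N ->
  [/\ ('E_P[fun w => (rwaiting D x k n w ^+ m)%R] <= M%:E)%E,
      ('E_P[fun w => (rbusy D x k n w ^+ m)%R] <= M%:E)%E,
      (\int[P]_w (rqueue D x k w ^+ m) <= M%:E)%E,
      ('E_P[fun w => expR (eta * rwaiting D x k n w)] <= M%:E)%E &
      (\int[P]_w (expeR (eta%:E * rqueue D x k w)) <= M%:E)%E].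

Definition regret2 (D : nat -> nat) (x : nat -> T -> R * R) (f : R * R -> R)
    (xs : R * R) (L : nat) : \bar R :=
  (\sum_(1 <= k < L.+1)
     'E_P[fun w => (rduration D x k w * (f (x k w) - f xs))%R])%E.

(** B_k and V_k of the estimator; in the former [G] is a version of
    E[H_k - grad f(x_k) | F_k]. *)
Definition bias (G : T -> R * R) : \bar R :=
  ((\int[P]_w (enorm (G w) ^+ 2)%:E) `^ (2^-1))%E.
Definition second_moment (H : T -> R * R) : \bar R :=
  'E_P[fun w => (enorm (H w) ^+ 2)%R]%E.

End Cycles.

(** The first index k0 such that 2 eta_k K0 <= 1 for all k >= k0, that is,
    1 + max {k >= 1 | 2 eta_k K0 > 1}, or 1 if this set is empty.  The
    successor is needed: the step made at an index k with 2 eta_k K0 > 1 can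
    take x_(k+1) as far from the minimizer as the rectangle allows. *)
Definition is_k0 (R : realType) (K0 : R) (step : nat -> R) (k0 : nat) :=
  [/\ (1 <= k0)%N,
      forall k, (k0 <= k)%N -> 2 * step k * K0 <= 1 &
      k0 = 1%N \/ 1 < 2 * step k0.-1 * K0].

Definition constC (R : realType) (Q : queue_model R) (k0 : nat)
    (beta K0 K3 : R) : R :=
  Num.max (k0%:R `^ beta * (`|mu_hi Q - mu_lo Q| ^+ 2 + `|p_hi Q - p_lo Q| ^+ 2))
          (8 * K3 / K0).

(* Main.v *)
(* Write N_k = ||x_k - x*||^2.  The projection is nonexpansive, so
     N_(k+1) <= N_k - 2 eta_k <H_k, x_k - x*> + eta_k^2 ||H_k||^2.
   Conditionally on F_k, H_k may be replaced by grad f(x_k) + G_k; the gradient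
   contributes -2 eta_k K0 N_k, and Young's inequality with weight
   c_k = K0 k^-beta / 8 bounds the bias by eta_k c_k (1 + N_k) in expectation.
   With (a) and (c), b_k = E N_k <= C k^-beta propagates from k to k + 1 once
   2 eta_k K0 <= 1; before that the diameter of the rectangle suffices.

   For the regret, f(x_k) - f(x* ) <= K1 N_k by the mean value theorem, and N_k
   is F_k-measurable.  Pathwise, T_k is at most the sum of U_n^k / lambda(p_hi)
   over the cycle plus the waiting time of the last customer of a queue that
   starts the cycle empty and runs with the slowest service and the lowest
   price.  This bound depends only on the primitives of cycle k, hence is
   independent of N_k, and its mean is at most D_k / lambda(p_hi) + M. *)

Require Import Defs.
From HB Require Import structures.
From mathcomp Require Import all_boot all_order all_algebra.
From mathcomp Require Import all_classical all_reals all_analysis.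
From mathcomp Require Import measurable_realfun zify ring lra.

Set Implicit Arguments.
Unset Strict Implicit.
Unset Printing Implicit Defensive.

Import Order.TTheory GRing.Theory Num.Theory.
Import numFieldNormedType.Exports.

Local Open Scope classical_set_scope.
Local Open Scope ring_scope.

(** * Geometry of the projected step *)

Section PlaneFacts.
Context {R : realType}.
Implicit Types a b x y z : R * R.

Lemma dot_ge0 a : 0 <= dot a a.
Proof. by rewrite /dot addr_ge0// -expr2 sqr_ge0. Qed.

Lemma enorm_ge0 a : 0 <= enorm a.
Proof. exact: sqrtr_ge0. Qed.

Lemma enorm_sqr a : enorm a ^+ 2 = dot a a.
Proof. exact/sqr_sqrtr/dot_ge0. Qed.

Lemma dot_le_enorm a b : dot a b <= enorm a * enorm b.
Proof.
rewrite (le_trans (ler_norm _))// -sqrtr_sqr /enorm -sqrtrM ?dot_ge0//.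
rewrite ler_sqrt ?mulr_ge0 ?dot_ge0//.
rewrite -subr_ge0 /dot [leRHS](_ : _ = (a.1 * b.2 - a.2 * b.1) ^+ 2).
  exact: sqr_ge0.
by ring.
Qed.

Lemma enorm_scale (t : R) a : enorm (t * a.1, t * a.2) = `|t| * enorm a.
Proof.
rewrite /enorm -sqrtr_sqr -sqrtrM ?sqr_ge0//; congr Num.sqrt.
by rewrite /dot /=; ring.
Qed.

Lemma enorm_le a b : (enorm a <= enorm b) = (dot a a <= dot b b).
Proof. by rewrite -!enorm_sqr ler_sqr// nnegrE enorm_ge0. Qed.

(** The nearest point [z] satisfies the variational inequality [c <= 0]: the vectors from [z] to [y]
    and from [z] to a point [x] of [B] form no acute angle. Expanding the squared distance from [y]
    to [x] around [z] then gives the claim. *)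
Lemma proj_dist_le (B : set (R * R)) y z x :
  (forall a b t, B a -> B b -> 0 <= t <= 1 ->
    B (a.1 + t * (b.1 - a.1), a.2 + t * (b.2 - a.2))) ->
  is_proj B y z -> B x -> dot (z - x) (z - x) <= dot (y - x) (y - x).
Proof.
move=> cvxB [Bz zmin] Bx.
set c := dot (y - z) (x - z); set m := dot (x - z) (x - z).
(* Minimality of [z] is tested against the point at parameter [t] on the segment from [z] to [x]. *)
have key t : 0 <= t <= 1 -> 2 * t * c <= t ^+ 2 * m.
  move=> t01; have := zmin _ (cvxB _ _ _ Bz Bx t01).
  rewrite enorm_le /c /m /dot /= => h; rewrite -subr_ge0.
  move: h; rewrite -subr_ge0; congr (_ <= _); ring.
have c_le0 : c <= 0.
  rewrite leNgt; apply/negP => c0.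
  have m0 : 0 < m.
    have := key 1; rewrite ler01 lexx => /(_ isT); lra.
  (* If [c > 0], the parameter [c / m], which minimizes [t ^+ 2 * m - 2 * t * c], gives a
     contradiction when it lies in the unit interval; otherwise [t = 1] does. *)
  have [cm|/ltW mc] := leP c m.
    have := key (c / m).
    rewrite divr_ge0 ?(ltW c0) ?(ltW m0)// ler_pdivrMr// mul1r cm => /(_ isT).
    rewrite expr_div_n [_ / _ ^+ 2 * m](_ : _ = c ^+ 2 / m); last first.
      by field; rewrite gt_eqF.
    rewrite [2 * _ * c](_ : _ = 2 * (c ^+ 2 / m)); last by field; rewrite gt_eqF.
    have : 0 < c ^+ 2 / m by rewrite divr_gt0// exprn_gt0.
    lra.
  have := key 1; rewrite ler01 lexx => /(_ isT); lra.
have -> : dot (y - x) (y - x)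
    = dot (y - z) (y - z) - 2 * c + dot (z - x) (z - x).
  by rewrite /c /dot /=; ring.
have := dot_ge0 (y - z); lra.
Qed.

End PlaneFacts.

(** * Mean value bound along a segment *)

(** The hypothesis is differentiability relative to the closed unit interval, the form that
    [gradient_on] yields on a segment. It gives true derivatives inside and one-sided continuity at
    the endpoints, which is what [MVT] asks for. *)
Lemma mean_value_unit (R : realType) (phi dphi : R -> R) :
  (forall t, 0 <= t <= 1 -> forall e, 0 < e -> exists2 r, 0 < r &
     forall s, 0 <= s <= 1 -> `|s - t| < r ->
       `|phi s - phi t - (s - t) * dphi t| <= e * `|s - t|) ->
  exists2 c, 0 < c < 1 & phi 1 - phi 0 = dphi c.
Proof.
move=> dp.
have [||c c01] := @MVT R phi dphi 0 1 ltr01.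
- move=> t; rewrite in_itv/= => /andP[t0 t1].
  have lim : h^-1 *: (phi (h *: 1 + t) - phi t) @[h --> (0:R)^'] --> dphi t.
    apply/cvgrPdist_le => e e0.
    have [|r r0 hr] := dp t _ e e0; first by rewrite !ltW.
    near=> h.
    have h0 : h != 0 by near: h; exact: nbhs_dnbhs_neq.
    (* The bounds [t] and [1 - t] keep [h + t] in the unit interval. *)
    have hs : `|h| < Num.min r (Num.min t (1 - t)).
      near: h; apply: dnbhs0_lt; rewrite !lt_min r0 t0 subr_gt0//.
    move: hs; rewrite !lt_min => /and3P[h1 h2 h3].
    have st : 0 <= h + t <= 1 by move: h2 h3; rewrite !ltr_norml; lra.
    have := hr (h + t) st; rewrite addrK => /(_ h1) H.
    rewrite distrC -(ler_pM2l (_ : 0 < `|h|)) ?normr_gt0// -normrM mulrBr.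
    rewrite /GRing.scale/= mulr1 mulVKf// [`|h| * e]mulrC.
    exact: H.
  split; first exact: (cvgP _ lim).
  exact: (cvg_lim _ lim).
- apply/subspace_continuousP => t; rewrite /= in_itv/= => t01.
  apply/cvgrPdist_le => e e0; rewrite near_withinE.
  have [r r0 hr] := dp t t01 1 ltr01.
  have d0 : 0 < `|dphi t| + 1 by rewrite ltr_wpDl.
  near=> s; rewrite /= in_itv/= => s01.
  (* The hypothesis with error 1 makes [phi] Lipschitz at [t] with constant [|dphi t| + 1]. *)
  have : `|s - t| < Num.min r (e / (`|dphi t| + 1)).
    rewrite distrC; near: s; apply: nbhsx_ballx.
    by rewrite lt_min r0 divr_gt0.
  rewrite lt_min ltr_pdivlMr// => /andP[sr se].
  have := hr s s01 sr; rewrite mul1r => H.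
  rewrite distrC (_ : phi s - phi t
    = (phi s - phi t - (s - t) * dphi t) + (s - t) * dphi t); last by ring.
  rewrite (le_trans (ler_normD _ _))// normrM.
  rewrite (le_trans (lerD H (lexx _)))//.
  by rewrite (le_trans _ (ltW se))// mulrDr mulr1 addrC.
- by rewrite in_itv/= in c01; rewrite subr0 mulr1 => ->; exists c.
Unshelve. all: end_near.
Qed.

Section SmoothOnBox.
Context {R : realType} (B : set (R * R)) (f : R * R -> R) (g : R * R -> R * R).
Variables (xs : R * R) (K1 : R).

(** The gap is the inner product of [v] with the gradient at an intermediate point [y c]. That
    gradient has norm at most [K1 * enorm (y c - xs)], and [y c] is no farther from [xs] than [x]
    is. *)
Lemma gap_le_sqr_dist x :
  (forall a b t, B a -> B b -> 0 <= t <= 1 ->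
    B (a.1 + t * (b.1 - a.1), a.2 + t * (b.2 - a.2))) ->
  gradient_on B f g -> 0 <= K1 ->
  (forall y, B y -> enorm (g y) <= K1 * enorm (y - xs)) ->
  B xs -> B x -> f x - f xs <= K1 * dot (x - xs) (x - xs).
Proof.
move=> cvxB df K10 gK Bxs Bx; set v := x - xs.
pose y t : R * R := (xs.1 + t * v.1, xs.2 + t * v.2).
have By t : 0 <= t <= 1 -> B (y t) by move=> t01; exact: cvxB.
have yB s t : y s - y t = ((s - t) * v.1, (s - t) * v.2).
  by rewrite [LHS]surjective_pairing; congr pair; rewrite /=; ring.
have [] := @mean_value_unit R (f \o y) (fun t => dot (g (y t)) v).
  move=> t t01 e e0.
  (* The added 1 keeps the divisor positive when [x = xs]. *)
  have v0 : 0 < enorm v + 1 by rewrite ltr_wpDl// enorm_ge0.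
  have [|r r0 hr] := df _ (By _ t01) (e / (enorm v + 1)).
    by rewrite divr_gt0.
  exists (r / (enorm v + 1)); first by rewrite divr_gt0.
  move=> s s01; rewrite ltr_pdivlMr// => sr.
  have := hr (y s) (By _ s01).
  rewrite yB enorm_scale (_ : dot _ (_, _) = (s - t) * dot (g (y t)) v); last first.
    by rewrite /dot /=; ring.
  move=> /(_ _)/le_trans; apply.
    by apply: le_lt_trans sr; rewrite ler_wpM2l// lerDl.
  rewrite mulrAC ler_pdivrMr// mulrA ler_wpM2l ?mulr_ge0 ?(ltW e0)//.
  by rewrite lerDl.
move=> c /andP[c0 c1].
have -> : (f \o y) 1 = f x.
  by rewrite /= /y [in RHS](surjective_pairing x); congr (f (_, _)); rewrite /=; ring.
have -> : (f \o y) 0 = f xs by rewrite /= /y !mul0r !addr0 -surjective_pairing.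
move=> ->; have c01 : 0 <= c <= 1 by rewrite !ltW.
rewrite (le_trans (dot_le_enorm _ _))// -enorm_sqr expr2 mulrA.
rewrite ler_wpM2r ?enorm_ge0// (le_trans (gK _ (By _ c01)))//.
rewrite ler_wpM2l// (_ : y c - xs = (c * v.1, c * v.2)); last first.
  by rewrite [LHS]surjective_pairing; congr pair; rewrite /=; ring.
by rewrite enorm_scale ger0_norm ?(ltW c0)// ler_piMl ?enorm_ge0// ltW.
Qed.

End SmoothOnBox.

(** * The deterministic recursion *)

(** With [s = eta * K0], one step contracts the bound [C * u] by [1 - s], while passing from [k] to
    [k.+1] in the power costs at most the factor [1 + s / 2]. The product of the two factors is at
    most 1. *)
Lemma power_decay_step (R : realType) (K0 K3 C eta beta b b' : R) (k : nat) :
  (1 <= k)%N -> 0 < beta -> 0 < K0 <= 1 -> 1 <= K3 -> 8 * K3 / K0 <= C ->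
  0 < eta -> 2 * eta * K0 <= 1 ->
  (1 + k%:R^-1) `^ beta <= 1 + K0 / 2 * eta ->
  0 <= b <= C * k%:R `^ (- beta) ->
  b' <= b - 2 * eta * K0 * b + eta * (K0 / 8 * k%:R `^ (- beta) * (1 + b))
        + eta * (K3 * k%:R `^ (- beta)) ->
  b' <= C * k.+1%:R `^ (- beta).
Proof.
move=> k1 beta0 /andP[K00 K01] K31 CK eta0 etaK ha /andP[b0 bC] hb'.
have kR : 0 < k%:R :> R by rewrite ltr0n.
set u := k%:R `^ (- beta) in bC hb' *.
have u0 : 0 < u by rewrite powR_gt0.
have u1 : u <= 1.
  rewrite /u powRN invf_le1 ?powR_gt0//.
  have := @ge0_ler_powR R beta (ltW beta0) 1 k%:R.
  by rewrite powR1 ler1n k1; apply; rewrite ?nnegrE ?ler01 ?ler0n.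
have uS : k.+1%:R `^ (- beta) = u / (1 + k%:R^-1) `^ beta.
  rewrite (_ : k.+1%:R = k%:R * (1 + k%:R^-1)); last first.
    by rewrite mulrDr mulr1 mulfV ?gt_eqF// -natr1.
  by rewrite powRM ?(ltW kR)// ?addr_ge0 ?invr_ge0 ?(ltW kR)// -/u powRN.
have C0 : 8 * K3 <= C * K0 by rewrite -ler_pdivrMr.
rewrite uS mulrA ler_pdivlMr ?powR_gt0 ?ltr_wpDr ?invr_ge0 ?(ltW kR)//.
have Cge0 : 0 <= C by rewrite (le_trans _ CK)// divr_ge0 ?mulr_ge0 ?ltW// (lt_le_trans _ K31).
(* As [u <= 1], the bias costs [s / 8] of the contraction [2 * s], leaving [15 / 8 * s]. Since
   [C * K0 >= 8 * K3] and [K3 >= 1 >= K0], the remaining noise takes at most [7 / 8 * s] of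
   [C * u]. *)
have bnd : b' <= C * u * (1 - eta * K0).
  have h1 : K0 / 8 * u * (1 + b) <= K0 / 8 * (u + b).
    by rewrite -mulrA ler_pM2l ?divr_gt0// mulrDr mulr1 lerD2l ler_piMl.
  have h2 : eta * (K0 / 8 * u * (1 + b)) <= eta * (K0 / 8 * (u + b)) by rewrite ler_pM2l.
  have h3 : b * (1 - 15 / 8 * (eta * K0)) <= C * u * (1 - 15 / 8 * (eta * K0)).
    by rewrite ler_wpM2r//; lra.
  have h4 : eta * u * (K0 / 8 + K3) <= eta * u * (C * K0 * 7 / 8).
    by rewrite ler_pM2l ?mulr_gt0//; lra.
  lra.
have eK : 0 < eta * K0 by rewrite mulr_gt0.
have Cu0 : 0 <= C * u by rewrite mulr_ge0// ltW.
rewrite (le_trans (ler_wpM2r _ bnd)) ?powR_ge0//.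
rewrite -(mulrA (C * u)) -[leRHS]mulr1 ler_wpM2l//.
apply: (@le_trans _ _ ((1 - eta * K0) * (1 + K0 / 2 * eta))).
  by rewrite ler_wpM2l//; lra.
rewrite -subr_ge0 (_ : _ - _ = eta * K0 / 2 + (eta * K0) ^+ 2 / 2); last by field.
by rewrite addr_ge0// divr_ge0// ?sqr_ge0// ltW.
Qed.

Lemma measurable_dot d (T : measurableType d) (R : realType)
    (X Y : T -> R * R) : measurable_fun setT X -> measurable_fun setT Y ->
  measurable_fun setT (fun w => dot (X w) (Y w)).
Proof.
move=> mX mY; apply: measurable_funD; apply: measurable_funM.
- exact: measurableT_comp measurable_fst mX.
- exact: measurableT_comp measurable_fst mY.
- exact: measurableT_comp measurable_snd mX.
- exact: measurableT_comp measurable_snd mY.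
Qed.

Lemma measurable_sqr_dist (R : realType) (xs : R * R) :
  measurable_fun [set: R * R] (fun z => dot (z - xs) (z - xs)).
Proof.
have m1 : measurable_fun [set: R * R] (fun z => z.1 - xs.1).
  by apply: measurable_funB => //; exact: measurable_fst.
have m2 : measurable_fun [set: R * R] (fun z => z.2 - xs.2).
  by apply: measurable_funB => //; exact: measurable_snd.
by apply: measurable_funD; apply: measurable_funM.
Qed.

(** * Orthogonality and independence *)

Section RealIntegrals.
Context d (T : measurableType d) (R : realType) (P : probability T R).
Implicit Types f g h : T -> R.

Lemma integrable_bounded_mul h f (b : R) : measurable_fun setT h ->
  (forall w, `|h w| <= b) -> P.-integrable setT (EFin \o f) ->
  P.-integrable setT (EFin \o (fun w => h w * f w)).
Proof.
move=> mh hb fi.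
have := @integrableMr _ _ _ P setT measurableT h (EFin \o f) mh.
apply => //; exists b; split; first exact: num_real.
by move=> r br w _ /=; rewrite (le_trans (hb w))// ltW.
Qed.

Lemma integrable_bounded h (b : R) : measurable_fun setT h ->
  (forall w, `|h w| <= b) -> P.-integrable setT (EFin \o h).
Proof.
move=> mh hb; have := integrable_bounded_mul mh hb
  (@finite_measure_integrable_cst _ _ _ P setT 1 measurableT).
by apply: eq_integrable => // w _ /=; rewrite mulr1.
Qed.

Lemma integrable_scale (k : R) f : P.-integrable setT (EFin \o f) ->
  P.-integrable setT (EFin \o (fun w => k * f w)).
Proof.
move=> fi; have := @integrableZl _ _ _ P setT measurableT k _ fi.
by apply: eq_integrable.
Qed.

Lemma integrable_add f g : P.-integrable setT (EFin \o f) ->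
  P.-integrable setT (EFin \o g) ->
  P.-integrable setT (EFin \o (fun w => f w + g w)).
Proof.
move=> fi gi; have := integrableD measurableT fi gi.
by apply: eq_integrable.
Qed.

Lemma integral_EFin f : P.-integrable setT (EFin \o f) ->
  (\int[P]_w (f w)%:E = (\int[P]_w f w)%:E)%E.
Proof. by move=> fi; rewrite /Rintegral fineK//; exact: integrable_fin_num. Qed.

(* No measurability is required: cycle durations are not known to be measurable. *)
Lemma le_integral_nonneg (f1 f2 : T -> \bar R) :
  (forall w, 0 <= f1 w <= f2 w)%E ->
  (\int[P]_w f1 w <= \int[P]_w f2 w)%E.
Proof.
move=> f12; rewrite !ge0_integralTE//.
- apply: ereal_sup_le => _ [h /= hf <-]; exists h => // w.
  by apply: le_trans (hf w) _; have /andP[] := f12 w.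
- by move=> w; have /andP[/le_trans] := f12 w; apply.
- by move=> w; have /andP[] := f12 w.
Qed.

End RealIntegrals.

(** The sum counts the positive integers up to [y], so it is the integer part of [y]. *)
Lemma layer_sum (R : realType) (y : R) (n : nat) : 0 <= y <= n%:R ->
  \sum_(1 <= j < n.+1) (j%:R <= y)%R%:R <= y <=
  \sum_(1 <= j < n.+1) (j%:R <= y)%R%:R + 1.
Proof.
elim: n => [|n IH] /andP[y0 yn].
  by rewrite big_geq// add0r y0 (le_trans yn).
have [yn'|ny] := leP y n%:R.
  have /negbTE nSy : ~~ (n.+1%:R <= y).
    by rewrite -ltNge (le_lt_trans yn') ?ltr_nat.
  rewrite big_nat_recr//= nSy addr0.
  by apply: IH; rewrite y0.
have -> : \sum_(1 <= j < n.+2) (j%:R <= y)%R%:R = n%:R + (n.+1%:R <= y)%R%:R :> R.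
  rewrite big_nat_recr//=; congr (_ + _).
  rewrite (eq_big_nat _ _ (F2 := fun=> 1)).
    by rewrite sumr_const_nat subn1.
  by move=> j /andP[_ jn]; rewrite (le_trans _ (ltW ny))// ler_nat.
move: yn; rewrite -natr1 => yn.
by case: (leP (n%:R + 1) y) => h /=; apply/andP; split; lra.
Qed.

Section Orthogonality.
Context d (T : measurableType d) (R : realType) (P : probability T R).
Variables (G : set (set T)).
Hypothesis mG : <<s G>> `<=` measurable.

Lemma measurable_g_sigma d' (S : measurableType d') (h : T -> S) :
  measurable_fun [set: g_sigma_algebraType G] h ->
  measurable_fun [set: T] h.
Proof. by move=> mh _ A mA; apply: mG; exact: mh. Qed.

(* Layer-cake approximation: up to an affine change, [h] is uniformly close to a
   finite sum of indicators of the sets [j <= y], which belong to [<<s G>>]. *)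
Lemma Rintegral_mul_orthogonal (Z h : T -> R) (b : R) :
  P.-integrable setT (EFin \o Z) ->
  (forall A, <<s G>> A -> \int[P]_(w in A) Z w = 0) ->
  measurable_fun [set: g_sigma_algebraType G] h ->
  (forall w, `|h w| <= b) ->
  \int[P]_w (h w * Z w) = 0.
Proof.
move=> Zi Z0 mh hb.
have b0 : 0 <= b by rewrite (le_trans _ (hb point)).
have mh' := measurable_g_sigma mh.
have Zn : P.-integrable setT (EFin \o (fun w => `|Z w|)).
  exact: integrable_norm.
suff H (e : R) : 0 < e -> `|\int[P]_w (h w * Z w)| <= e * \int[P]_w `|Z w|.
  apply/eqP; rewrite -normr_eq0 eq_le normr_ge0 andbT.
  apply/ler_addgt0Pr => e e0; rewrite add0r.
  have I0 : 0 <= \int[P]_w `|Z w| by exact: Rintegral_ge0.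
  rewrite (le_trans (H (e / (\int[P]_w `|Z w| + 1)) _))//.
    by rewrite divr_gt0// ltr_wpDl.
  by rewrite mulrAC ler_pdivrMr ?ltr_wpDl// ler_wpM2l ?(ltW e0)// lerDl.
move=> e0.
(* The shift by [b] makes [y] nonnegative, and unit layers of [y] are layers of height [e] of
   [h]. *)
pose y w := (h w + b) / e.
have my : measurable_fun [set: g_sigma_algebraType G] y.
  by apply: measurable_funM => //; apply: measurable_funD.
pose S n w : R := \sum_(1 <= j < n.+1) (j%:R <= y w)%R%:R.
have mA j : <<s G>> [set w | j%:R <= y w].
  have := @measurable_fun_le _ (g_sigma_algebraType G) R setT (cst j%:R) y.
  rewrite setTI; apply=> //; exact: measurableT.
have indA j : (fun w => (j%:R <= y w)%R%:R) = \1_[set w | j%:R <= y w] :> (T -> R).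
  by apply/funext => w; rewrite indicE mem_setE.
have layer j : measurable_fun [set: g_sigma_algebraType G]
    (fun w => (j%:R <= y w)%R%:R : R).
  rewrite indA.
  exact: (@measurable_indic _ (g_sigma_algebraType G) R setT _ (mA j)).
have layerZ j : P.-integrable setT
    (EFin \o (fun w => (j%:R <= y w)%R%:R * Z w)).
  apply: (@integrable_bounded_mul _ _ _ _ _ _ 1) => //.
    exact: measurable_g_sigma.
  by move=> w; case: (j%:R <= y w); rewrite /= ?normr1 ?normr0.
have SZ n : P.-integrable setT (EFin \o (fun w => S n w * Z w)) /\
    \int[P]_w (S n w * Z w) = 0.
  elim: n => [|n [IH1 IH2]].
    have E w : S 0%N w * Z w = 0 by rewrite /S big_geq// mul0r.
    split.
      apply: (eq_integrable measurableT (cst 0%E)); last exact: integrable0.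
      by move=> w _; rewrite /= E.
    by rewrite (@eq_Rintegral _ _ _ P setT (cst 0)) ?Rintegral_cst ?mul0r// => w _ /=.
  have E w : S n.+1 w * Z w = S n w * Z w + (n.+1%:R <= y w)%R%:R * Z w.
    by rewrite /S big_nat_recr//= mulrDl.
  split.
    have := integrableD measurableT IH1 (layerZ n.+1).
    by apply: eq_integrable => // w _; rewrite /= E.
  rewrite (@eq_Rintegral _ _ _ P setT (fun w => S n w * Z w + (n.+1%:R <= y w)%R%:R * Z w)).
    rewrite RintegralD// IH2 add0r -[RHS](Z0 _ (mA n.+1)) [RHS]Rintegral_mkcond.
    apply: eq_Rintegral => w _.
    by rewrite patch_indic -indA/= mulrC.
  by move=> w _; rewrite E.
(* [2 * b / e] bounds [y], so [n] layers suffice. *)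
pose n := (Num.truncn (2 * b / e)).+1.
have yS w : `|y w - S n w| <= 1.
  have : 0 <= y w <= n%:R.
    have := hb w; rewrite ler_norml => /andP[h1 h2].
    rewrite divr_ge0 ?(ltW e0)//=; last lra.
    rewrite (le_trans _ (ltW (truncnS_gt _)))// ler_pM2r ?invr_gt0//.
    by rewrite mulr_natl mulr2n lerD2r.
  move=> /layer_sum; rewrite -/(S n w) ler_norml => /andP[h1 h2].
  by apply/andP; split; lra.
have mS : measurable_fun setT (S n).
  by apply: measurable_sum => j; exact: measurable_g_sigma.
have my' := measurable_g_sigma my.
have iyS : P.-integrable setT (EFin \o (fun w => (y w - S n w) * Z w)).
  by apply: (integrable_bounded_mul _ yS) => //; exact: measurable_funB.
(* Here [h = e * (y - S n) + e * S n - b], and the last two terms integrate to 0 against [Z]. *)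
have -> : \int[P]_w (h w * Z w) = e * \int[P]_w ((y w - S n w) * Z w).
  have ihZ : P.-integrable setT (EFin \o (fun w => h w * Z w)).
    exact: (integrable_bounded_mul _ hb).
  have ieyS : P.-integrable setT (EFin \o (fun w => e * ((y w - S n w) * Z w))).
    exact: integrable_scale.
  have ieS : P.-integrable setT (EFin \o (fun w => e * (S n w * Z w))).
    exact/integrable_scale/(SZ n).1.
  have ibZ : P.-integrable setT (EFin \o (fun w => b * Z w)).
    exact: integrable_scale.
  rewrite -RintegralZl//.
  transitivity (\int[P]_w (e * ((y w - S n w) * Z w) + e * (S n w * Z w)
      - b * Z w)).
    apply: eq_Rintegral => w _.
    by rewrite /y; field; rewrite gt_eqF.
  rewrite RintegralB//; last exact: integrable_add.
  rewrite RintegralD// [X in _ + X - _]RintegralZl ?(SZ n).2 ?mulr0//; last first.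
    exact: (SZ n).1.
  rewrite [X in _ - X]RintegralZl// Z0 ?mulr0 ?subr0 ?addr0//.
  exact: (@measurableT _ (g_sigma_algebraType G)).
rewrite normrM gtr0_norm// ler_pM2l//.
rewrite (le_trans (le_normr_Rintegral _ _))//.
apply: le_Rintegral => //; first exact: integrable_norm.
by move=> w _ /=; rewrite normrM ler_piMl.
Qed.

End Orthogonality.

Section Independence.
Context d (T : measurableType d) (R : realType) (P : probability T R).

Section Cylinders.
Variables (I : eqType) (X : I -> T -> R).
Hypothesis mX : forall i, measurable_fun setT (X i).

(** A pi-system generating the sigma-algebra of the variables [X j] with [j] in [J]. *)
Definition cylinders (J : seq I) : set (set T) :=
  [set \bigcap_(j in [set` J]) (X j @^-1` A j)
     | A in [set A : I -> set R | forall j, measurable (A j)]].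

Lemma cylinders_measurable J : cylinders J `<=` measurable.
Proof.
move=> _ [A /= mA <-]; apply: fin_bigcap_measurable; first exact: finite_seq.
by move=> j _; rewrite -[_ @^-1` _]setTI; exact: mX.
Qed.

Lemma cylinders_sigma_measurable J : <<s cylinders J >> `<=` measurable.
Proof.
apply: smallest_sub; last exact: cylinders_measurable.
exact: sigma_algebra_measurable.
Qed.

Lemma cylinders_setI J : setI_closed (cylinders J).
Proof.
move=> _ _ [A /= mA <-] [B /= mB <-]; exists (fun j => A j `&` B j).
  by move=> j; exact: measurableI.
by rewrite -bigcapI; apply: eq_bigcapr => j _; rewrite preimage_setI.
Qed.

Lemma cylinders_preimage J j (A : set R) : j \in J -> measurable A ->
  cylinders J (X j @^-1` A).
Proof.
move=> jJ mA; exists (fun i => if i == j then A else setT).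
  by move=> i /=; case: ifP.
apply/seteqP; split => w /=.
  by move=> /(_ j jJ) /=; rewrite eqxx.
by move=> Aw i _ /=; case: eqP => // ->.
Qed.

Lemma measurable_cylinders J j : j \in J ->
  measurable_fun [set: g_sigma_algebraType (cylinders J)] (X j).
Proof.
move=> jJ _ A mA; rewrite setTI; apply: sub_sigma_algebra.
exact: cylinders_preimage.
Qed.

Hypothesis indepX : mutually_independent P X.

Lemma indep_cylinders J K A B : uniq (J ++ K) ->
  cylinders J A -> cylinders K B -> P (A `&` B) = (P A * P B)%E.
Proof.
move=> uJK [A' /= mA <-] [B' /= mB <-].
have [uJ /hasPn nJK uK] : [/\ uniq J, ~~ has (mem J) K & uniq K].
  by apply/and3P; rewrite -cat_uniq.
(* As [J] and [K] are disjoint, the two cylinders intersect in a single cylinder over [J ++ K]. *)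
pose C j := if j \in J then A' j else B' j.
have mC j : measurable (C j) by rewrite /C; case: ifP.
have CJ j : j \in J -> C j = A' j by rewrite /C => ->.
have CK j : j \in K -> C j = B' j.
  by move=> /nJK /= /negbTE; rewrite /C => ->.
have -> : \bigcap_(j in [set` J]) (X j @^-1` A' j) `&`
          \bigcap_(j in [set` K]) (X j @^-1` B' j) =
          \bigcap_(j in [set` J ++ K]) (X j @^-1` C j).
  apply/seteqP; split => w /=.
    move=> [hA hB] j /=; rewrite mem_cat => /orP[jJ|jK].
      by rewrite CJ//; exact: hA.
    by rewrite CK//; exact: hB.
  move=> h; split => j /= jJK; have := h j; rewrite /= mem_cat jJK ?orbT.
    by rewrite CJ//; exact.
  by rewrite CK//; exact.
rewrite !indepX// big_cat/=; congr (_ * _)%E; apply: eq_big_seq => j jJK.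
  by rewrite CJ.
by rewrite CK.
Qed.

(** The product formula is extended from cylinders to the generated sigma-algebras one factor at a
    time, by uniqueness of finite measures on a pi-system. *)
Lemma indep_sigma_cylinders J K A B : uniq (J ++ K) ->
  <<s cylinders J >> A -> <<s cylinders K >> B -> P (A `&` B) = (P A * P B)%E.
Proof.
move=> uJK sA sB.
have extend (G : set (set T)) (E : set T) : measurable E ->
    G `<=` measurable -> setI_closed G ->
    (forall F, G F -> P (F `&` E) = (P F * P E)%E) ->
    forall F, <<s G >> F -> P (F `&` E) = (P F * P E)%E.
  move=> mE mG GI GE F sF.
  have PE0 : 0 <= fine (P E) by exact: fine_ge0.
  have PEf : P E \is a fin_num by exact: fin_num_measure.
  have HG : [set A0 | G A0 /\ A0 `<=` setT] = G.
    by apply/seteqP; split => [? []//|? ?]; split.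
  (* The two measures compared are [P] restricted to [E] and [P] scaled by [P E]; both have total
     mass [P E]. *)
  have m12 F' : mscale (NngNum PE0) P F' = (P F' * P E)%E.
    by rewrite /mscale/= fineK// muleC.
  have := @g_sigma_algebra_measure_unique_trace _ R T G setT measurableT.
  rewrite HG => /(_ mG GI (mrestr P mE) (mscale (NngNum PE0) P)) /=.
  move=> /(_ _ _ _ _ F sF) uniq_ext; rewrite -m12; apply: uniq_ext => //.
  - by rewrite m12 /mrestr setTI probability_setT mul1e.
  - by move=> A0 GA0; rewrite m12; exact: GE.
  - by rewrite /mrestr setTI -ge0_fin_numE.
apply: (extend _ B _ _ _ _ _ sA).
- exact: cylinders_sigma_measurable sB.
- exact: cylinders_measurable.
- exact: cylinders_setI.
move=> A' cA; rewrite setIC muleC; apply: (extend _ A' _ _ _ _ _ sB).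
- exact: cylinders_measurable cA.
- exact: cylinders_measurable.
- exact: cylinders_setI.
by move=> B' cB; rewrite setIC muleC; exact: (indep_cylinders uJK).
Qed.

End Cylinders.
End Independence.

Section IndependentProduct.
Context d (T : measurableType d) (R : realType) (P : probability T R).
Variables (G1 G2 : set (set T)).
Hypotheses (mG1 : <<s G1>> `<=` measurable) (mG2 : <<s G2>> `<=` measurable).
Hypothesis indep : forall A B, <<s G1>> A -> <<s G2>> B ->
  P (A `&` B) = (P A * P B)%E.
Variables (N : T -> R) (b : R).
Hypothesis mN : measurable_fun [set: g_sigma_algebraType G1] N.
Hypothesis Nb : forall w, 0 <= N w <= b.

Let mNT : measurable_fun setT N.
Proof. exact: (measurable_g_sigma mG1). Qed.

Let Nnorm w : `|N w| <= b.
Proof. by have /andP[N0 ?] := Nb w; rewrite ger0_norm. Qed.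

Let iN : P.-integrable setT (EFin \o N).
Proof. exact: (integrable_bounded P _ Nnorm). Qed.

Let indic_integral A B : measurable A -> measurable B ->
  \int[P]_(w in A) \1_B w = fine (P (A `&` B)).
Proof. by move=> mA mB; rewrite /Rintegral integral_indic// setIC. Qed.

(* Independence enters twice through orthogonality: [\1_B - P B] is orthogonal to
   [<<s G1>>], and then [N - E N] is orthogonal to [<<s G2>>]. *)
Let mean_on B : <<s G2>> B ->
  \int[P]_(w in B) N w = fine (P B) * \int[P]_w N w.
Proof.
move=> sB; have mB := mG2 sB.
have i1 : P.-integrable setT (EFin \o \1_B) by exact: integrable_indic.
have i2 : P.-integrable setT (EFin \o cst (fine (P B))).
  exact: finite_measure_integrable_cst.
have iZ : P.-integrable setT (EFin \o (\1_B \- cst (fine (P B)))).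
  by have := integrableB measurableT i1 i2; apply: eq_integrable.
have := @Rintegral_mul_orthogonal _ _ _ _ _ mG1 _ N b iZ _ mN Nnorm.
move=> /(_ _)/wrap[A sA|].
  have mA := mG1 sA.
  rewrite RintegralB//; [|exact: (integrableS measurableT)..].
  rewrite indic_integral// Rintegral_cst// indep// fineM ?fin_num_measure//.
  by rewrite mulrC subrr.
move=> orth; apply/eqP; rewrite -subr_eq0 -orth; apply/eqP.
rewrite Rintegral_mkcond -RintegralZl// -RintegralB//; last first.
- exact: integrable_scale.
- by rewrite -restrict_EFin -integrable_mkcond//; exact: integrableS iN.
by apply: eq_Rintegral => w _; rewrite patch_indic /=; ring.
Qed.

Let mean_mul (Z : T -> R) (m : R) : measurable_fun [set: g_sigma_algebraType G2] Z ->
  (forall w, 0 <= Z w <= m) ->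
  \int[P]_w (N w * Z w) = \int[P]_w N w * \int[P]_w Z w.
Proof.
move=> mZ Zm; set EN := \int[P]_w N w.
have Znorm w : `|Z w| <= m by have /andP[Z0 ?] := Zm w; rewrite ger0_norm.
have mZT : measurable_fun setT Z := measurable_g_sigma mG2 mZ.
have iZ : P.-integrable setT (EFin \o Z) by exact: (integrable_bounded P _ Znorm).
have icst : P.-integrable setT (EFin \o cst EN).
  exact: finite_measure_integrable_cst.
have iNE : P.-integrable setT (EFin \o (N \- cst EN)).
  by have := integrableB measurableT iN icst; apply: eq_integrable.
have := @Rintegral_mul_orthogonal _ _ _ _ _ mG2 _ Z m iNE _ mZ Znorm.
move=> /(_ _)/wrap[B sB|].
  have mB := mG2 sB.
  rewrite RintegralB//; [|exact: (integrableS measurableT)..].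
  by rewrite mean_on// Rintegral_cst// mulrC subrr.
move=> orth; apply/eqP; rewrite -subr_eq0 -orth; apply/eqP.
rewrite -RintegralZl// -RintegralB//; last first.
- exact: integrable_scale.
- exact: (integrable_bounded_mul _ Nnorm).
by apply: eq_Rintegral => w _ /=; ring.
Qed.

(** [Z] may be unbounded: the product formula holds for its truncations [Zn n], and monotone
    convergence passes the upper bound to the limit. *)
Lemma expectation_indep_mul_le (Z : T -> R) :
  measurable_fun [set: g_sigma_algebraType G2] Z ->
  (forall w, 0 <= Z w) ->
  (\int[P]_w (N w * Z w)%:E <=
   \int[P]_w (N w)%:E * \int[P]_w (Z w)%:E)%E.
Proof.
move=> mZ Z0; have mZT := measurable_g_sigma mG2 mZ.
pose Zn (n : nat) w := Num.min (Z w) n%:R.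
have mZn n : measurable_fun [set: g_sigma_algebraType G2] (Zn n).
  exact: (@measurable_minr _ (g_sigma_algebraType G2)).
have Zn0 n w : 0 <= Zn n w <= n%:R by rewrite le_min Z0 ler0n ge_min lexx orbT.
have N0 w : 0 <= N w by have /andP[] := Nb w.
have lim w : ((N w * Zn n w)%:E @[n --> \oo] --> (N w * Z w)%:E)%E.
  apply: cvg_near_cst; near=> n; rewrite /Zn min_l//.
  near: n; exists (Num.truncn (Z w)).+1 => // n /= h.
  by rewrite (le_trans (ltW (truncnS_gt _)))// ler_nat.
have := @cvg_monotone_convergence _ T R P setT measurableT
  (fun n w => (N w * Zn n w)%:E).
move=> /(_ _ _ _)/wrap[n|n w _|w _ m n mn|].
- apply/measurable_EFinP/measurable_funM => //.
  exact: (measurable_g_sigma mG2).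
- by rewrite lee_fin mulr_ge0//; have /andP[] := Zn0 n w.
- rewrite lee_fin ler_wpM2l// le_min ge_min lexx/= ge_min.
  by rewrite ler_nat mn orbT.
rewrite (eq_integral (fun w => (N w * Z w)%:E)); last first.
  by move=> w _; exact/cvg_lim.
move=> cvgI; rewrite -(cvg_lim _ cvgI)//.
apply: lime_le; first by apply/cvg_ex; eexists; exact: cvgI.
near=> n; rewrite [X in (_ <= X * _)%E]integral_EFin//.
have iZn : P.-integrable setT (EFin \o Zn n).
  apply: (@integrable_bounded _ _ _ _ _ n%:R).
    exact: (measurable_g_sigma mG2).
  by move=> w; have /andP[z0 zn] := Zn0 n w; rewrite ger0_norm.
have iNZn : P.-integrable setT (EFin \o (fun w => N w * Zn n w)).
  exact: (integrable_bounded_mul mNT Nnorm).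
rewrite [leLHS](integral_EFin iNZn) (mean_mul (mZn n) (Zn0 n)) EFinM -(integral_EFin iZn).
rewrite lee_wpmul2l ?lee_fin ?Rintegral_ge0//.
apply: ge0_le_integral => //.
- by move=> w _; have /andP[] := Zn0 n w; rewrite lee_fin.
- exact/measurable_EFinP/(measurable_g_sigma mG2).
- exact/measurable_EFinP.
- by move=> w _; rewrite lee_fin ge_min lexx.
Unshelve. all: end_near.
Qed.

End IndependentProduct.

(** * Duration of a cycle *)

Section Paths.
Context {R : realType}.
Variables (lam : R -> R) (D : nat -> nat) (u v : nat -> R).
Implicit Types (x y : nat -> R * R) (prc : nat -> R).

(** Repricing only ever installs some [(x k).2], and the initial price is [(x 1).2]. *)
Lemma prices_in x (S : R -> Prop) : (forall k, (1 <= k)%N -> S (x k).2) ->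
  forall k i, S (prices lam D x u v k i).
Proof.
move=> Sx; rewrite /prices; elim => [|k IH] i /=; first exact: Sx.
case: (cycle_end _ _ _ _ _ k) IH => [[prc w0] x0] /= IH.
by rewrite /reprice; case: ifP => _ //; exact: Sx.
Qed.

Lemma wait_at_ge0 x prc k w0 n : 0 <= w0 -> 0 <= wait_at lam D x u v prc k w0 n.
Proof. by case: n => //= n _; rewrite le_max lexx. Qed.

Lemma W0_ge0 x k : 0 <= W0 lam D x u v k.
Proof.
rewrite /W0; elim: k.-1 => [|j IH] //=.
case: (cycle_end _ _ _ _ _ j) IH => [[prc w0] x0] /= IH.
exact: wait_at_ge0.
Qed.

Hypothesis u0 : forall i, 0 <= u i.
Hypothesis v0 : forall i, 0 <= v i.

(** Coupling on common primitives: the waiting-time recursion increases with service times,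
    decreases with interarrival times, and does not amplify an initial excess [c]. *)
Lemma wait_at_le x y prc prc' k (c w0 w0' : R) n :
  0 <= c -> w0 <= c + w0' -> 0 < (y k).1 <= (x k).1 ->
  (forall i, 0 < lam (prc i) <= lam (prc' i)) ->
  wait_at lam D x u v prc k w0 n <= c + wait_at lam D y u v prc' k w0' n.
Proof.
move=> c0 w00 /andP[y0 yx] hlam; elim: n => [|n IH] //=.
set i := (served D k + n)%N.
have /andP[l0 ll] := hlam i.
have hv : v i / (x k).1 <= v i / (y k).1.
  by rewrite ler_wpM2l// lef_pV2// posrE// (lt_le_trans y0).
have hu : u i / lam (prc' i) <= u i / lam (prc i).
  by rewrite ler_wpM2l// lef_pV2// posrE// (lt_le_trans l0).
rewrite ge_max addr_ge0 ?le_max ?lexx//=.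
have : wait_at lam D y u v prc' k w0' n + v i / (y k).1 - u i / lam (prc' i) <=
  Num.max 0 (wait_at lam D y u v prc' k w0' n + v i / (y k).1 - u i / lam (prc' i)).
  by rewrite le_max lexx orbT.
lra.
Qed.

Section Duration.
Variables (x : nat -> R * R) (k : nat) (m p q : R).
Hypothesis m0 : 0 < m <= (x k).1.
Hypothesis lam_bounds : forall i,
  [&& 0 < lam q, lam q <= lam (prices lam D x u v k i) &
      lam (prices lam D x u v k i) <= lam p].

Lemma durationE : duration lam D x u v k =
  arrival_at lam D u (prices lam D x u v k) k (D k) +
  waiting lam D x u v k (D k) - W0 lam D x u v k.
Proof.
by rewrite /duration /entry /arrival_at big_ord0 add0r /waiting.
Qed.

(** Entry times into service are nondecreasing: customer [n.+1] enters at least one service time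
    after customer [n]. *)
Lemma duration_ge0 : 0 <= duration lam D x u v k.
Proof.
rewrite durationE /waiting subr_ge0; set prc := prices _ _ _ _ _ _.
elim: (D k) => [|n IH]; first by rewrite /arrival_at big_ord0 add0r.
rewrite (le_trans IH)//= /arrival_at big_ord_recr/= -!addrA lerD2l.
set i := (served D k + n)%N; set wt := wait_at _ _ _ _ _ _ _ _ _.
have : wt + v i / (x k).1 - u i / lam (prc i)
    <= Num.max 0 (wt + v i / (x k).1 - u i / lam (prc i)).
  by rewrite le_max lexx orbT.
have : 0 <= v i / (x k).1.
  by have /andP[m1 m2] := m0; rewrite divr_ge0// (le_trans _ m2)// ltW.
rewrite !addrA; lra.
Qed.

Lemma duration_le : duration lam D x u v k <=
  \sum_(i < D k) u (served D k + i)%N / lam q +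
  wait_at lam D (fun=> (m, p)) u v (fun=> p) k 0 (D k).
Proof.
have /andP[mgt0 mx] := m0.
rewrite durationE -addrA lerD//.
  apply: ler_sum => i _; rewrite ler_wpM2l//.
  have /and3P[q0 qi _] := lam_bounds (served D k + i)%N.
  by rewrite lef_pV2// posrE// (lt_le_trans q0).
(* The initial wait is the excess [c] of the coupling, so subtracting it leaves a comparison queue
   that starts empty. *)
rewrite lerBlDl; apply: wait_at_le => //; first exact: W0_ge0.
  by rewrite addr0.
by move=> i; have /and3P[q0 qi ->] := lam_bounds i; rewrite (lt_le_trans q0).
Qed.

End Duration.

(* The constant policy provides a copy of the dominating queue to which the
   moment bound applies; there cycle k does not start empty. *)
Lemma wait_at_empty_le (m p : R) k n : 0 < m -> 0 < lam p ->
  wait_at lam D (fun=> (m, p)) u v (fun=> p) k 0 n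
  <= waiting lam D (fun=> (m, p)) u v k n.
Proof.
move=> m0 lp; rewrite -[leRHS]add0r; apply: wait_at_le => //=.
- by rewrite add0r W0_ge0.
- by rewrite m0 lexx.
- move=> i; rewrite (prices_in (S := fun t => t = p))// lp lexx.
  by [].
Qed.

End Paths.

(** * Index blocks and the history *)

Section WindowIndices.
(** Indices, in the joint family, of the primitives [U i] and [V i] with [a <= i < a + n]. The past
    of cycle [k] is [window 0 (served D k)], and the cycle itself is [window (served D k) (D k)]. *)
Definition window (a n : nat) : seq (nat + nat) :=
  [seq inl i | i <- iota a n] ++ [seq inr i | i <- iota a n].

Lemma mem_window_inl a n i : (inl i \in window a n) = (a <= i < a + n)%N.
Proof.
rewrite mem_cat mem_map; last by move=> ? ? [].
rewrite mem_iota; case: (_ <= _ < _)%N => //=.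
by apply/negP => /mapP[].
Qed.

Lemma mem_window_inr a n i : (inr i \in window a n) = (a <= i < a + n)%N.
Proof.
rewrite mem_cat orbC mem_map; last by move=> ? ? [].
rewrite mem_iota; case: (_ <= _ < _)%N => //=.
by apply/negP => /mapP[].
Qed.

Lemma window_uniq a n : uniq (window a n).
Proof.
rewrite cat_uniq !map_inj_uniq ?iota_uniq/= ?andbT; last 2 first.
- by move=> ? ? [].
- by move=> ? ? [].
by apply/hasPn => _ /mapP[i _ ->]; apply/negP => /mapP[].
Qed.

Lemma window_cat_uniq a n m : uniq (window a n ++ window (a + n) m).
Proof.
rewrite cat_uniq !window_uniq/= andbT; apply/hasPn => -[] i /=.
  by rewrite !mem_window_inl; lia.
by rewrite !mem_window_inr; lia.
Qed.

End WindowIndices.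

Section History.
Context {d : measure_display} {T : measurableType d} {R : realType}.
Variables (P : probability T R) (U V : nat -> {RV P >-> R}) (D : nat -> nat).

(** The family whose mutual independence is asserted in [primitives]. *)
Definition joint (i : nat + nat) : T -> R :=
  match i with inl n => U n : T -> R | inr n => V n : T -> R end.

Lemma measurable_joint i : measurable_fun setT (joint i).
Proof. by case: i => n; exact: measurable_funPT. Qed.

Definition history_gen (k : nat) : set (set T) :=
  \bigcup_(i in [set i | (i < served D k)%N])
    (preimage_set_system setT (U i : T -> R) measurable `|`
     preimage_set_system setT (V i : T -> R) measurable).

Lemma history_sub_cylinders k :
  history U V D k `<=` <<s cylinders joint (window 0 (served D k)) >>.
Proof.
apply: smallest_sub; first exact: smallest_sigma_algebra.
move=> A [i /= ik [] [B mB <-]]; rewrite setTI; apply: sub_sigma_algebra.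
  apply: (@cylinders_preimage _ _ _ _ joint _ (inl i)) => //.
  by rewrite mem_window_inl.
apply: (@cylinders_preimage _ _ _ _ joint _ (inr i)) => //.
by rewrite mem_window_inr.
Qed.

Lemma history_measurable k : <<s history_gen k>> `<=` measurable.
Proof.
apply: subset_trans (@history_sub_cylinders k) _.
exact/cylinders_sigma_measurable/measurable_joint.
Qed.

Lemma adapted_measurable d' (S : measurableType d') (X : T -> S) k :
  adapted_to (history U V D k) X ->
  measurable_fun [set: g_sigma_algebraType (history_gen k)] X.
Proof. by move=> aX _ A mA; apply: aX; exists A. Qed.

(** This makes constant policies admissible in [moment_bound]. *)
Lemma adapted_cst d' (S : measurableType d') (s : S) k :
  adapted_to (history U V D k) (fun=> s).
Proof.
move=> _ [A mA <-].
exact: (@measurable_cst _ _ (g_sigma_algebraType (history_gen k)) S setT s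
  measurableT A mA).
Qed.

(** Started empty at a constant price, the queue forgets the past and uses only primitives of the
    block; this is the source of independence from the history. *)
Lemma measurable_wait_at (lam : R -> R) (m p : R) k N n : (n <= N)%N ->
  measurable_fun
    [set: g_sigma_algebraType (cylinders joint (window (served D k) N))]
    (fun w => wait_at lam D (fun=> (m, p)) (fun i => U i w) (fun i => V i w)
      (fun=> p) k 0 n).
Proof.
set G := cylinders _ _.
have mU i : (i < N)%N ->
    measurable_fun [set: g_sigma_algebraType G] (U (served D k + i)).
  move=> iN; apply: (@measurable_cylinders _ _ _ _ joint _ (inl _)).
  by rewrite mem_window_inl; lia.
have mV i : (i < N)%N ->
    measurable_fun [set: g_sigma_algebraType G] (V (served D k + i)).
  move=> iN; apply: (@measurable_cylinders _ _ _ _ joint _ (inr _)).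
  by rewrite mem_window_inr; lia.
elim: n => [|n IH] nN; first exact: (@measurable_cst _ _ (g_sigma_algebraType G)).
apply: (@measurable_maxr _ (g_sigma_algebraType G)).
  exact: (@measurable_cst _ _ (g_sigma_algebraType G)).
apply: (@measurable_funB _ (g_sigma_algebraType G)).
  apply: (@measurable_funD _ (g_sigma_algebraType G)); first exact: (IH (ltnW nN)).
  apply: (@measurable_funM _ (g_sigma_algebraType G)); first (exact: (mV n nN)).
  exact: (@measurable_cst _ _ (g_sigma_algebraType G)).
apply: (@measurable_funM _ (g_sigma_algebraType G)); first (exact: (mU n nN)).
exact: (@measurable_cst _ _ (g_sigma_algebraType G)).
Qed.

End History.

(** * Expected regret of one cycle *)

Section PolicyRegret.
Context {d : measure_display} {T : measurableType d} {R : realType}.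
Variables (P : probability T R) (Q : queue_model R).
Variables (U V : nat -> {RV P >-> R}) (eta M : R).
Variables (D : nat -> nat) (x : nat -> T -> R * R).
Hypotheses (Qok : valid_model Q) (UV : primitives U V) (Qstab : stability Q).
Hypothesis momM : moment_bound Q U V eta M.
Hypothesis D1 : forall k, (1 <= k)%N -> (1 <= D k)%N.
Hypothesis xpol : is_policy Q U V D x.

Let lamp_hi := lam Q (p_hi Q).
Let lamp_hi_gt0 : 0 < lamp_hi.
Proof.
have [_ /andP[_ /ltW ph] _ l0] := Qok.
by apply: l0; rewrite in_itv/= ph lexx.
Qed.

Let lo_box : box Q (mu_lo Q, p_lo Q).
Proof.
have [/andP[_ /ltW mh] /andP[_ /ltW ph] _ _] := Qok.
by split; rewrite /= in_itv/= lexx ?mh ?ph.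
Qed.

Let U0 i w : 0 <= U i w. Proof. by have [_ _ _ /(_ i w)[]] := UV. Qed.
Let V0 i w : 0 <= V i w. Proof. by have [_ _ _ /(_ i w)[]] := UV. Qed.

(* Waiting time of the last customer of cycle k if the cycle started empty and
   the slowest service and the lowest price were used throughout it. *)
Definition empty_wait k w : R :=
  wait_at (lam Q) D (fun=> (mu_lo Q, p_lo Q)) (fun i => U i w)
    (fun i => V i w) (fun=> p_lo Q) k 0 (D k).

Definition cycle_bound k w : R :=
  \sum_(i < D k) U (served D k + i)%N w / lamp_hi + empty_wait k w.

Let lam_bounds k w i : (1 <= k)%N ->
  [&& 0 < lamp_hi, lamp_hi <= lam Q (prices (lam Q) D (fun k => x k w)
        (fun i => U i w) (fun i => V i w) k i) &
      lam Q (prices (lam Q) D (fun k => x k w)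
        (fun i => U i w) (fun i => V i w) k i) <= lam Q (p_lo Q)].
Proof.
move=> k1.
have pr : prices (lam Q) D (fun k => x k w) (fun i => U i w) (fun i => V i w) k i
    \in `[p_lo Q, p_hi Q].
  apply: (@prices_in R (lam Q) D _ _ _ (fun t => is_true (t \in `[p_lo Q, p_hi Q]))) => j j1.
  by have [/(_ w)[]] := xpol j1.
have [_ /andP[_ /ltW ph] _ _] := Qok; have [_ lam_noninc _ _ _] := Qstab.
have := pr; rewrite in_itv/= => /andP[pl pu].
rewrite lamp_hi_gt0 /=; apply/andP; split; apply: lam_noninc => //.
  by rewrite in_itv/= ph lexx.
by rewrite in_itv/= lexx ph.
Qed.

Let mu_bounds k w : (1 <= k)%N -> 0 < mu_lo Q <= (x k w).1.
Proof.
move=> k1; have [/andP[m0 _] _ _ _] := Qok; rewrite m0.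
by have [/(_ w)[]] := xpol k1; rewrite in_itv/= => /andP[].
Qed.

Lemma rduration_ge0 k w : (1 <= k)%N -> 0 <= rduration Q U V D x k w.
Proof.
move=> k1; rewrite /rduration /on_path.
by apply: (duration_ge0 _ _ _ (fun i => V0 i w) (x := fun k => x k w)
  (mu_bounds w k1)).
Qed.

Lemma rduration_le k w : (1 <= k)%N -> rduration Q U V D x k w <= cycle_bound k w.
Proof.
move=> k1; rewrite /rduration /on_path.
by apply: (duration_le (fun i => U0 i w) (fun i => V0 i w)
  (x := fun k => x k w) (mu_bounds w k1) (fun i => lam_bounds w i k1)).
Qed.

Lemma empty_wait_ge0 k w : 0 <= empty_wait k w.
Proof. exact: wait_at_ge0. Qed.

Lemma measurable_cycle_bound k : measurable_fun
  [set: g_sigma_algebraType (cylinders (joint U V) (window (served D k) (D k)))]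
  (cycle_bound k).
Proof.
set G := cylinders _ _.
apply: (@measurable_funD _ (g_sigma_algebraType G)).
  apply: (@measurable_sum _ (g_sigma_algebraType G)) => i.
  apply: (@measurable_funM _ (g_sigma_algebraType G)); last first.
    exact: (@measurable_cst _ _ (g_sigma_algebraType G)).
  apply: (@measurable_cylinders _ _ _ _ (joint U V) _ (inl _)).
  by rewrite mem_window_inl leq_addr ltn_add2l/=.
exact: measurable_wait_at.
Qed.

(** The moment bound is applied, with first moment and last customer, to the constant policy
    [(mu_lo Q, p_lo Q)], whose queue dominates the one that starts the cycle empty. *)
Lemma expected_empty_wait k : (1 <= k)%N ->
  (\int[P]_w (empty_wait k w)%:E <= M%:E)%E.
Proof.
move=> k1; have [_ /(_ D (fun=> fun=> (mu_lo Q, p_lo Q)) D1)] := momM.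
have pol : is_policy Q U V D (fun=> fun=> (mu_lo Q, p_lo Q)).
  by move=> j j1; split => //; exact: adapted_cst.
move=> /(_ pol k (D k) 1%N k1); rewrite D1// leqnn => /(_ isT isT)[+ _ _ _ _].
rewrite unlock; apply: le_trans; apply: le_integral_nonneg => w.
rewrite !lee_fin empty_wait_ge0/= expr1; apply: wait_at_empty_le => //.
  by have [/andP[]] := Qok.
by have [_ _ _] := Qok; apply; have [] := lo_box.
Qed.

Lemma expected_cycle_bound k : (1 <= k)%N ->
  (\int[P]_w (cycle_bound k w)%:E <= ((D k)%:R / lamp_hi + M)%:E)%E.
Proof.
move=> k1.
have mJ := @measurable_joint _ _ _ P U V.
have mw : measurable_fun setT (empty_wait k).
  apply: measurable_g_sigma; last exact: measurable_wait_at.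
  exact: cylinders_sigma_measurable.
have mU i : measurable_fun setT (fun w => U i w / lamp_hi).
  by apply: measurable_funM => //; exact: measurable_funPT.
rewrite (eq_integral (fun w =>
  \sum_(i < D k) (U (served D k + i)%N w / lamp_hi)%:E + (empty_wait k w)%:E)%E);
  last by move=> w _; rewrite /cycle_bound EFinD -sumEFin.
rewrite ge0_integralD//; last 4 first.
- by move=> w _; rewrite sume_ge0// => i _; rewrite lee_fin divr_ge0// ltW.
- by apply: emeasurable_sum => i; exact/measurable_EFinP.
- by move=> w _; rewrite lee_fin empty_wait_ge0.
- exact/measurable_EFinP.
rewrite EFinD leeD ?expected_empty_wait//.
rewrite ge0_integral_sum//; last 2 first.
- by move=> i; exact/measurable_EFinP.
- by move=> i w _; rewrite lee_fin divr_ge0// ltW.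
rewrite (eq_bigr (fun=> (lamp_hi^-1)%:E)).
  by rewrite sumEFin sumr_const card_ord mulr_natl.
move=> i _; have [_ _ _ _ /(_ (served D k + i)%N)[+ _]] := UV.
rewrite unlock => EU.
under eq_integral do rewrite EFinM.
rewrite ge0_integralZr ?EU ?mul1e//.
- exact/measurable_EFinP/measurable_funPT.
- by move=> w _; rewrite lee_fin.
- by rewrite lee_fin invr_ge0 ltW.
Qed.

Lemma expected_cycle_regret_le k (g : R * R -> R) (xs : R * R) (K1 b : R) :
  (1 <= k)%N -> 0 <= K1 ->
  (forall w, 0 <= g (x k w) - g xs <= K1 * dot (x k w - xs) (x k w - xs)) ->
  (forall w, dot (x k w - xs) (x k w - xs) <= b) ->
  (0 <= 'E_P[fun w => (rduration Q U V D x k w * (g (x k w) - g xs))%R] <=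
   (K1 * ((D k)%:R / lamp_hi + M))%:E *
     \int[P]_w (dot (x k w - xs) (x k w - xs))%:E)%E.
Proof.
move=> k1 K10 hg hb; rewrite unlock.
set N := fun w => dot (x k w - xs) (x k w - xs).
have cb0 w : 0 <= cycle_bound k w.
  exact: le_trans (rduration_ge0 w k1) (rduration_le w k1).
apply/andP; split.
  apply: integral_ge0 => w _; rewrite lee_fin mulr_ge0 ?rduration_ge0//.
  by have /andP[] := hg w.
have mJ := @measurable_joint _ _ _ P U V.
have mN : measurable_fun [set: g_sigma_algebraType (history_gen U V D k)] N.
  exact: measurableT_comp (measurable_sqr_dist xs)
    (adapted_measurable (xpol k1).2).
(* The past and the current cycle occupy consecutive, hence disjoint, windows of primitives. *)
have indep A B : <<s history_gen U V D k >> A ->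
    <<s cylinders (joint U V) (window (served D k) (D k)) >> B ->
    P (A `&` B) = (P A * P B)%E.
  move=> sA sB; have [indJ _ _ _ _] := UV.
  apply: (@indep_sigma_cylinders _ _ _ _ _ (joint U V) mJ indJ
    (window 0 (served D k)) (window (served D k) (D k))) => //.
    exact: (window_cat_uniq 0).
  exact: history_sub_cylinders.
(* The duration itself depends on the past; its pathwise majorant [cycle_bound] does not, and
   replaces it before the expectation is factored. *)
apply: (@le_trans _ _ (\int[P]_w (K1%:E * (N w * cycle_bound k w)%:E))%E).
  apply: le_integral_nonneg => w; rewrite -EFinM !lee_fin.
  have /andP[g0 gK] := hg w; have d0 := rduration_ge0 w k1.
  rewrite mulr_ge0//= mulrC mulrA ler_pM//; exact: rduration_le.
have mNT := measurable_g_sigma (@history_measurable _ _ _ _ U V D k) mN.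
have mcb : measurable_fun setT (cycle_bound k).
  apply: measurable_g_sigma; last exact: measurable_cycle_bound.
  exact: cylinders_sigma_measurable.
rewrite ge0_integralZl//; last 2 first.
- exact/measurable_EFinP/measurable_funM.
- by move=> w _; rewrite lee_fin mulr_ge0// dot_ge0.
rewrite [in leRHS]EFinM -muleA lee_wpmul2l ?lee_fin//.
rewrite muleC (le_trans (expectation_indep_mul_le _ _ indep (b := b) _ _ _ _))//.
- exact: history_measurable.
- exact: cylinders_sigma_measurable.
- by move=> w; rewrite dot_ge0 hb.
- exact: measurable_cycle_bound.
rewrite lee_wpmul2l ?expected_cycle_bound// integral_ge0// => w _.
by rewrite lee_fin dot_ge0.
Qed.

End PolicyRegret.

(** * The stochastic recursion *)

Section ProjectedStep.
Context {d : measure_display} {T : measurableType d} {R : realType}.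
Variables (P : probability T R).

(** An infinite second moment would have an infinite square root, so a finite bound on the bias can
    be squared. *)
Lemma integral_sqr_le_bias (Y : T -> R * R) (c : R) : 0 <= c ->
  (bias P Y <= c%:E)%E ->
  (\int[P]_w (dot (Y w) (Y w))%:E <= (c ^+ 2)%:E)%E.
Proof.
rewrite /bias => c0.
under eq_integral do rewrite enorm_sqr.
have : (0 <= \int[P]_w (dot (Y w) (Y w))%:E)%E.
  by apply: integral_ge0 => w _; rewrite lee_fin dot_ge0.
case: (\int[P]_w _)%E => [r| |] //=; last by rewrite invr_eq0 pnatr_eq0.
rewrite !lee_fin => r0; rewrite powR12_sqrt// => rc.
by rewrite -(sqr_sqrtr r0) ler_sqr ?nnegrE ?sqrtr_ge0.
Qed.

Lemma integrable_nonneg (f : T -> R) (b : R) : measurable_fun setT f ->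
  (forall w, 0 <= f w) -> (\int[P]_w (f w)%:E <= b%:E)%E ->
  P.-integrable setT (EFin \o f) /\ \int[P]_w f w <= b.
Proof.
move=> mf f0 fb.
have fi : P.-integrable setT (EFin \o f).
  apply/integrableP; split; first exact/measurable_EFinP.
  under eq_integral do rewrite /= ger0_norm//.
  by rewrite (le_lt_trans fb)// ltry.
by split => //; rewrite -lee_fin -integral_EFin.
Qed.

(** [X - Y] integrates to 0 over every event of [<<s F>>], so the orthogonality lemma applies to
    it. *)
Lemma cond_exp_orthogonal (F : set (set T)) (X Y h : T -> R) (b : R) :
  <<s F>> `<=` measurable -> is_cond_exp P <<s F>> X Y ->
  measurable_fun [set: g_sigma_algebraType F] h -> (forall w, `|h w| <= b) ->
  P.-integrable setT (EFin \o (fun w => h w * (X w - Y w))) /\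
  \int[P]_w (h w * (X w - Y w)) = 0.
Proof.
move=> mF [iX iY _ XY] mh hb.
have iZ : P.-integrable setT (EFin \o (X \- Y)).
  by have := integrableB measurableT iX iY; apply: eq_integrable.
split; first exact: (integrable_bounded_mul (measurable_g_sigma mF mh) hb iZ).
apply: (@Rintegral_mul_orthogonal _ _ _ _ F mF (X \- Y) h b) => // A FA.
have mA := mF _ FA.
rewrite RintegralB//; [|exact: (integrableS measurableT)..].
by rewrite /Rintegral XY// subrr.
Qed.

(** Here [H - Z] is the gradient at [X] and [G] the conditional mean of the error [Z]. Thus [H]
    splits into [H - Z], handled by [K0], the part [Z - G], orthogonal to [X - xs], and [G], handled
    by Young's inequality. Its weight [c] is also the bias bound, so both resulting terms are of
    order [eta * c]. *)
Lemma projected_step (F : set (set T)) (X X' H Z G : T -> R * R) (xs : R * R)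
    (K0 eta b c v : R) :
  <<s F>> `<=` measurable -> 0 < eta -> 0 < c ->
  measurable_fun [set: g_sigma_algebraType F] X ->
  measurable_fun setT X' -> measurable_fun setT H ->
  (forall w, dot (X w - xs) (X w - xs) <= b) ->
  (forall w, K0 * dot (X w - xs) (X w - xs) <= dot (X w - xs) (H w - Z w)) ->
  (forall w, let y := ((X w).1 - eta * (H w).1, (X w).2 - eta * (H w).2) in
     dot (X' w - xs) (X' w - xs) <= dot (y - xs) (y - xs)) ->
  is_cond_exp2 P <<s F>> Z G ->
  (bias P G <= c%:E)%E ->
  (eta%:E * second_moment P H <= v%:E)%E ->
  let e := \int[P]_w dot (X w - xs) (X w - xs) in
  \int[P]_w dot (X' w - xs) (X' w - xs) <=
  e - 2 * eta * K0 * e + eta * (c * (1 + e)) + eta * v.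
Proof.
move=> mF eta0 c0 mX mX' mH Xb grad proj [ceG1 ceG2] biasG momH.
set N := fun w => dot (X w - xs) (X w - xs); set e := \int[P]_w N w => /=.
have mXT := measurable_g_sigma mF mX.
have mN : measurable_fun setT N := measurableT_comp (measurable_sqr_dist xs) mXT.
have mN' := measurableT_comp (measurable_sqr_dist xs) mX'.
have iN : P.-integrable setT (EFin \o N).
  apply: (integrable_bounded P mN (b := b)) => w.
  by rewrite ger0_norm ?dot_ge0// Xb.
have [_ mG1' _ _] := ceG1; have [_ mG2' _ _] := ceG2.
have mG : measurable_fun setT (fun w => dot (G w) (G w)).
  have m1 : measurable_fun setT (fun w => (G w).1).
    exact/measurable_EFinP/(measurable_int P mG1').
  have m2 : measurable_fun setT (fun w => (G w).2).
    exact/measurable_EFinP/(measurable_int P mG2').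
  by apply: measurable_funD; apply: measurable_funM.
have [iG IG] := integrable_nonneg mG (fun w => dot_ge0 _)
  (integral_sqr_le_bias (ltW c0) biasG).
have [iH IH] : P.-integrable setT (EFin \o (fun w => dot (H w) (H w))) /\
    \int[P]_w (dot (H w) (H w)) <= v / eta.
  apply: integrable_nonneg; first exact: measurable_dot.
    by move=> w; exact: dot_ge0.
  move: momH; rewrite /second_moment unlock.
  under eq_integral do rewrite enorm_sqr.
  by rewrite muleC -lee_pdivlMr// EFinM.
(* Orthogonality is used coordinatewise and needs bounded coordinates; [|r| <= r * r + 1] provides
   them. *)
have coord_le (t s : R) : t * t + s * s <= b -> `|t| <= b + 1 /\ `|s| <= b + 1.
  have sq (r : R) : `|r| <= r * r + 1.
    have : 0 <= (`|r| - 1) ^+ 2 by exact: sqr_ge0.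
    by rewrite sqrrB1 real_normK ?num_real// expr2; have := normr_ge0 r; lra.
  have := sq t; have := sq s.
  have := sqr_ge0 t; have := sqr_ge0 s; rewrite !expr2; lra.
have v1 w : `|(X w).1 - xs.1| <= b + 1 by have [] := coord_le _ _ (Xb w).
have v2 w : `|(X w).2 - xs.2| <= b + 1 by have [] := coord_le _ _ (Xb w).
have mv1 : measurable_fun [set: g_sigma_algebraType F] (fun w => (X w).1 - xs.1).
  apply: (@measurable_funB _ (g_sigma_algebraType F)).
    exact: measurableT_comp measurable_fst mX.
  exact: (@measurable_cst _ _ (g_sigma_algebraType F)).
have mv2 : measurable_fun [set: g_sigma_algebraType F] (fun w => (X w).2 - xs.2).
  apply: (@measurable_funB _ (g_sigma_algebraType F)).
    exact: measurableT_comp measurable_snd mX.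
  exact: (@measurable_cst _ _ (g_sigma_algebraType F)).
have [iW1 IW1] := cond_exp_orthogonal mF ceG1 mv1 v1.
have [iW2 IW2] := cond_exp_orthogonal mF ceG2 mv2 v2.
set W1 := fun w => _ in iW1 IW1; set W2 := fun w => _ in iW2 IW2.
(* The coefficient of [N]: the gradient contributes [- 2 * eta * K0] and Young's inequality
   [eta * c]. In [rhs], [W1] and [W2] have mean 0. *)
pose a := 1 - 2 * eta * K0 + eta * c.
pose rhs w := (a * N w + - (2 * eta) * (W1 w + W2 w)) +
  (eta / c * dot (G w) (G w) + eta ^+ 2 * dot (H w) (H w)).
have iW := integrable_add iW1 iW2.
have iaN := integrable_scale a iN.
have ieW := integrable_scale (- (2 * eta)) iW.
have ieG := integrable_scale (eta / c) iG.
have ieH := integrable_scale (eta ^+ 2) iH.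
have iGH := integrable_add ieG ieH.
have iNW := integrable_add iaN ieW.
have irhs : P.-integrable setT (EFin \o rhs) by exact: integrable_add.
have N'rhs w : dot (X' w - xs) (X' w - xs) <= rhs w.
  apply: le_trans (proj w) _.
  (* - 2 <G, v> <= |G|^2 / c + c |v|^2 with v = X - xs *)
  have Gv : 0 <= dot (G w + (c * (X w - xs).1, c * (X w - xs).2))
                     (G w + (c * (X w - xs).1, c * (X w - xs).2)) by exact: dot_ge0.
  have {}Gv : 0 <= eta / c * dot (G w + (c * (X w - xs).1, c * (X w - xs).2))
                     (G w + (c * (X w - xs).1, c * (X w - xs).2)).
    by rewrite mulr_ge0// divr_ge0// ltW.
  have gv : 0 <= 2 * eta * (dot (X w - xs) (H w - Z w) - K0 * N w).
    by apply: mulr_ge0; [rewrite mulr_ge0// ltW|rewrite subr_ge0; exact: grad].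
  (* The slack in the inequality is exactly the sum of the nonnegative quantities in [Gv] and
     [gv]. *)
  rewrite -subr_ge0; apply: le_trans (addr_ge0 Gv gv) _; rewrite le_eqVlt.
  apply/orP; left; apply/eqP.
  by rewrite /rhs /W1 /W2 /N /a /dot /=; field; rewrite gt_eqF.
have iN' : P.-integrable setT (EFin \o (fun w => dot (X' w - xs) (X' w - xs))).
  apply: le_integrable irhs => //; first exact/measurable_EFinP.
  move=> w _; rewrite /= lee_fin !ger0_norm ?dot_ge0//.
  by rewrite (le_trans _ (N'rhs w))// dot_ge0.
apply: (le_trans (le_Rintegral measurableT iN' irhs (fun w _ => N'rhs w))).
rewrite RintegralD// RintegralD// RintegralD// !RintegralZl// (RintegralD measurableT iW1 iW2).
rewrite IW1 IW2 addr0 mulr0 addr0 -/e /a.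
have h1 : eta / c * \int[P]_w dot (G w) (G w) <= eta * c.
  rewrite -mulrA ler_pM2l// mulrC ler_pdivrMr// -expr2; exact: IG.
have h2 : eta ^+ 2 * \int[P]_w dot (H w) (H w) <= eta * v.
  by rewrite expr2 -mulrA ler_pM2l// mulrC -ler_pdivlMr.
lra.
Qed.

End ProjectedStep.

(** * The policy rectangle and the convergence rate *)

Section Box.
Context {R : realType} (Q : queue_model R).

Lemma box_convex (a b : R * R) (t : R) : box Q a -> box Q b -> 0 <= t <= 1 ->
  box Q (a.1 + t * (b.1 - a.1), a.2 + t * (b.2 - a.2)).
Proof.
have conv (l h r s : R) : l <= r <= h -> l <= s <= h -> 0 <= t <= 1 ->
    l <= r + t * (s - r) <= h.
  move=> /andP[lr rh] /andP[ls sh] /andP[t0 t1].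
  have -> : r + t * (s - r) = (1 - t) * r + t * s by ring.
  have t1' : 0 <= 1 - t by rewrite subr_ge0.
  have E (y : R) : y = (1 - t) * y + t * y by ring.
  by apply/andP; split; [rewrite (E l)|rewrite (E h)]; rewrite lerD// ler_wpM2l.
move=> [a1 a2] [b1 b2] t01; split; rewrite /= in_itv/=.
  by apply: conv.
by apply: conv.
Qed.

Lemma box_sqr_dist (a b : R * R) : box Q a -> box Q b ->
  dot (a - b) (a - b) <=
  `|mu_hi Q - mu_lo Q| ^+ 2 + `|p_hi Q - p_lo Q| ^+ 2.
Proof.
have side (l h r s : R) : l <= r <= h -> l <= s <= h ->
    (r - s) * (r - s) <= `|h - l| ^+ 2.
  move=> /andP[lr rh] /andP[ls sh].
  rewrite -expr2 -real_normK ?num_real// ler_sqr ?nnegrE//.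
  by rewrite [leRHS]ger0_norm ?ler_norml; lra.
move=> [a1 a2] [b1 b2]; rewrite /dot lerD//; exact: side.
Qed.

End Box.

Lemma bigO_le (R : realType) (f g : nat -> R) (A : R) :
  (forall n, `|f n| <= A * `|g n|) -> f =O_\oo g.
Proof.
move=> fg; apply/eqOP; near=> k; near=> n.
rewrite (le_trans (fg n))// ler_wpM2r//; near: k.
Unshelve. all: end_near.
Qed.

Theorem theorem2 (d : measure_display) (T : measurableType d) (R : realType)
    (P : probability T R) (Q : queue_model R) (U V : nat -> {RV P >-> R})
    (Winf : R * R -> probability (measurableTypeR R) R) (eta : R)
    (xs : R * R) (gradf : R * R -> R * R) (K0 K1 M : R)
    (D : nat -> nat) (x H G : nat -> T -> R * R) (step : nat -> R)
    (beta K3 : R) (k0 : nat) :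
  let f := objective Q Winf in
  let C := constC Q k0 beta K0 K3 in
  (* model and standing assumptions *)
  valid_model Q -> primitives U V -> stability Q -> light_tails Q U V eta ->
  steady_state Q U V Winf ->
  is_minimizer (box Q) f xs ->
  (* convexity assumption *)
  gradient_on (box Q) f gradf -> convexity (box Q) gradf xs K0 K1 ->
  moment_bound Q U V eta M ->
  (* cycles, estimators and the recursion *)
  (forall k, (1 <= k)%N -> (1 <= D k)%N) ->
  is_policy Q U V D x ->
  (forall k, (1 <= k)%N -> adapted_to (history U V D k.+1) (H k)) ->
  (forall k, (1 <= k)%N ->
     is_cond_exp2 P (history U V D k) (fun w => H k w - gradf (x k w)) (G k)) ->
  (forall k w, (1 <= k)%N ->
     is_proj (box Q) ((x k w).1 - step k * (H k w).1,
                      (x k w).2 - step k * (H k w).2) (x k.+1 w)) ->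
  step k @[k --> \oo] --> (0 : R) ->
  0 < beta <= 1 -> 1 <= K3 ->
  (* (a) *)
  (forall k, (1 <= k)%N -> (1 + k%:R^-1) `^ beta <= 1 + K0 / 2 * step k) ->
  (* (b) *)
  (forall k, (1 <= k)%N ->
     (bias P (G k) <= (K0 / 8 * k%:R `^ (- beta))%:E)%E) ->
  (* (c) *)
  (forall k, (1 <= k)%N ->
     ((step k)%:E * second_moment P (H k) <= (K3 * k%:R `^ (- beta))%:E)%E) ->
  is_k0 K0 step k0 ->
  [/\ 8 * K3 / K0 <= C,
      forall k, (1 <= k)%N ->
        ('E_P[fun w => (enorm (x k w - xs) ^+ 2)%R]
         <= (C * k%:R `^ (- beta))%:E)%E,
      forall L : nat,
        (regret2 Q U V D x f xs L
         <= (C * K1 * \sum_(1 <= k < L.+1)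
               ((D k)%:R / lam Q (p_hi Q) + M) * k%:R `^ (- beta))%:E)%E,
      (fun L : nat => C * K1 * \sum_(1 <= k < L.+1)
               ((D k)%:R / lam Q (p_hi Q) + M) * k%:R `^ (- beta))
        =O_\oo (fun L : nat => \sum_(1 <= k < L.+1) (D k)%:R * k%:R `^ (- beta)) &
      (fun L : nat => fine (regret2 Q U V D x f xs L))
        =O_\oo (fun L : nat => \sum_(1 <= k < L.+1) (D k)%:R * k%:R `^ (- beta))].
Proof.
move=> f C Qok UV Qstab _ _ [xs_box xs_min] df [/andP[K00 K01] K01' gradK] momM
  D1 xpol adH ceG proj _ /andP[beta0 beta1] K31 ha hb hc [k01 k0P _].
have K10 : 0 < K1 by exact: lt_trans K01'.
pose dd := `|mu_hi Q - mu_lo Q| ^+ 2 + `|p_hi Q - p_lo Q| ^+ 2.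
pose N k w := dot (x k w - xs) (x k w - xs).
pose b k := \int[P]_w N k w.
have x_box k w : (1 <= k)%N -> box Q (x k w) by move=> k1; exact: (xpol k k1).1.
have Ndd k w : (1 <= k)%N -> N k w <= dd.
  by move=> k1; exact: box_sqr_dist (x_box k w k1) xs_box.
have N0 k w : 0 <= N k w by exact: dot_ge0.
have mx k : (1 <= k)%N ->
    measurable_fun [set: g_sigma_algebraType (history_gen U V D k)] (x k).
  by move=> k1; exact: adapted_measurable (xpol k k1).2.
have mxT k : (1 <= k)%N -> measurable_fun setT (x k).
  by move=> k1; exact: (measurable_g_sigma (@history_measurable _ _ _ _ U V D k)
    (mx k k1)).
have iN k : (1 <= k)%N -> P.-integrable setT (EFin \o N k).
  move=> k1; apply: (integrable_bounded P (b := dd)).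
    exact: measurableT_comp (measurable_sqr_dist xs) (mxT k k1).
  by move=> w; rewrite ger0_norm ?N0 ?Ndd.
have b0 k : 0 <= b k by exact: Rintegral_ge0.
have bdd k : (1 <= k)%N -> b k <= dd.
  move=> k1; have icst : P.-integrable setT (EFin \o cst dd).
    exact: finite_measure_integrable_cst.
  rewrite (le_trans (le_Rintegral measurableT (iN k k1) icst _))//.
    by move=> w _; exact: Ndd.
  by rewrite Rintegral_cst//= probability_setT mulr1.
have CK : 8 * K3 / K0 <= C by rewrite /C /constC le_max lexx orbT.
have Cdd : k0%:R `^ beta * dd <= C by rewrite /C /constC le_max lexx.
have K30 : 0 < K3 by exact: lt_le_trans K31.
have C0 : 0 < C by rewrite (lt_le_trans _ CK)// divr_gt0// mulr_gt0.
(* Positivity of the steps comes from (a), whose left-hand side exceeds 1. *)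
have step0 k : (1 <= k)%N -> 0 < step k.
  move=> k1; have kR : 0 < k%:R :> R by rewrite ltr0n.
  have : 1 < (1 + k%:R^-1) `^ beta.
    have := @gt0_ltr_powR R beta beta0 1 (1 + k%:R^-1).
    rewrite powR1; apply; rewrite ?nnegrE ?addr_ge0 ?invr_ge0 ?(ltW kR)//.
    by rewrite ltrDl invr_gt0.
  move=> /lt_le_trans /(_ (ha k k1)); rewrite ltrDl.
  by rewrite pmulr_rgt0// divr_gt0.
have rate k : (1 <= k)%N -> b k <= C * k%:R `^ (- beta).
  (* Up to and including [k0] the squared diameter [dd] suffices, by the first term of the maximum
     in [C]. *)
  have early j : (1 <= j <= k0)%N -> b j <= C * j%:R `^ (- beta).
    move=> /andP[j1 jk0]; have jR : 0 < j%:R :> R by rewrite ltr0n.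
    rewrite powRN ler_pdivlMr ?powR_gt0// (le_trans _ Cdd)// mulrC.
    rewrite ler_pM ?powR_ge0 ?bdd// ge0_ler_powR ?nnegrE ?ler0n ?ler_nat//.
    exact: ltW.
  elim: k => [//|[|k] IH] _; first by apply: early; rewrite k01.
  (* Otherwise [k0 <= k.+1], so the step made at [k.+1] satisfies [2 * step k.+1 * K0 <= 1]. *)
  have [jk0|k0k] := leqP k.+2 k0; first exact: early.
  set j := k.+1 in IH k0k *.
  have j1 : (1 <= j)%N by [].
  have jR : 0 < j%:R :> R by rewrite ltr0n.
  have u0 : 0 < j%:R `^ (- beta) :> R by rewrite powR_gt0.
  apply: (power_decay_step j1 beta0 _ K31 CK (step0 _ j1) _ (ha _ j1)
    (b := b j)) => //.
  - by rewrite K00.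
  - exact: k0P.
  - by rewrite b0 IH.
  apply: (projected_step (F := history_gen U V D j) (H := H j) (G := G j)
    (X := x j) (Z := fun w => H j w - gradf (x j w)) (b := dd)) => //.
  - exact: history_measurable.
  - exact: step0.
  - by rewrite mulr_gt0// divr_gt0.
  - exact: mx.
  - exact: mxT.
  - apply: (measurable_g_sigma (@history_measurable _ _ _ _ U V D j.+1)).
    exact: adapted_measurable (adH j j1).
  - by move=> w; exact: Ndd.
  - move=> w; rewrite subKr -enorm_sqr.
    by have [] := gradK _ (x_box j w j1).
  - move=> w; apply: proj_dist_le xs_box; last exact: proj.
    by move=> a0 b1 t; exact: box_convex.
  - exact: ceG.
  - exact: hb.
  - exact: hc.
have EN k : (1 <= k)%N ->
    (\int[P]_w (N k w)%:E <= (C * k%:R `^ (- beta))%:E)%E.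
  by move=> k1; rewrite integral_EFin ?iN// lee_fin rate.
have lam0 : 0 < lam Q (p_hi Q).
  have [_ /andP[_ /ltW ph] _ l0] := Qok.
  by apply: l0; rewrite in_itv/= ph lexx.
have M0 : 0 < M by case: momM.
pose S L := \sum_(1 <= k < L.+1)
  ((D k)%:R / lam Q (p_hi Q) + M) * k%:R `^ (- beta).
have gap k w : (1 <= k)%N -> 0 <= f (x k w) - f xs <= K1 * N k w.
  move=> k1; rewrite subr_ge0 (xs_min _ (x_box k w k1))/=.
  apply: gap_le_sqr_dist df (ltW K10) _ xs_box (x_box k w k1).
    by move=> a0 b1 t; exact: box_convex.
  by move=> y /gradK[].
have per_cycle k : (1 <= k)%N ->
    (0 <= 'E_P[fun w => (rduration Q U V D x k w * (f (x k w) - f xs))%R] <=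
     (C * K1 * (((D k)%:R / lam Q (p_hi Q) + M) * k%:R `^ (- beta)))%:E)%E.
  move=> k1; have /andP[-> le] := expected_cycle_regret_le Qok UV Qstab momM D1
    xpol k1 (ltW K10) (fun w => gap k w k1) (fun w => Ndd k w k1).
  rewrite /= (le_trans le)//.
  have -> : C * K1 * (((D k)%:R / lam Q (p_hi Q) + M) * k%:R `^ (- beta)) =
      K1 * ((D k)%:R / lam Q (p_hi Q) + M) * (C * k%:R `^ (- beta)) by ring.
  rewrite [leRHS]EFinM lee_wpmul2l ?EN// lee_fin mulr_ge0 ?(ltW K10)//.
  by rewrite addr_ge0 ?(ltW M0)// divr_ge0 ?(ltW lam0).
have regret L : (0 <= regret2 Q U V D x f xs L <= (C * K1 * S L)%:E)%E.
  rewrite /regret2 /S mulr_sumr -sumEFin; apply/andP; split.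
    rewrite big_nat; apply: sume_ge0 => k /andP[k1 _].
    by have /andP[] := per_cycle k k1.
  rewrite big_nat [leRHS]big_nat; apply: lee_sum => k /andP[k1 _].
  by have /andP[] := per_cycle k k1.
have S0 L : 0 <= S L.
  apply: sumr_ge0 => k _; rewrite mulr_ge0 ?powR_ge0//.
  by rewrite addr_ge0 ?(ltW M0)// divr_ge0 ?(ltW lam0).
have CKS0 L : 0 <= C * K1 * S L by apply: mulr_ge0 => //; rewrite mulr_ge0// ltW.
(* As [D k >= 1], the constant [M] is absorbed into [M * D k]. *)
have CKS_O L : C * K1 * S L <= C * K1 * ((lam Q (p_hi Q))^-1 + M) *
    `|\sum_(1 <= k < L.+1) (D k)%:R * k%:R `^ (- beta)|.
  have CK10 : 0 <= C * K1 by rewrite mulr_ge0// ltW.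
  rewrite -[leRHS]mulrA ler_wpM2l//.
  rewrite ger0_norm; last by apply: sumr_ge0 => k _; rewrite mulr_ge0 ?powR_ge0.
  rewrite mulr_sumr /S big_nat [leRHS]big_nat; apply: ler_sum => k /andP[k1 _].
  rewrite mulrA ler_wpM2r ?powR_ge0// mulrDl [_^-1 * _]mulrC lerD2l.
  by rewrite ler_peMr ?(ltW M0)// ler1n D1.
split=> //.
- move=> k k1; rewrite unlock.
  by under eq_integral do rewrite enorm_sqr; exact: EN.
- by move=> L; have /andP[] := regret L.
- apply: (@bigO_le _ _ _ (C * K1 * ((lam Q (p_hi Q))^-1 + M))) => L.
  by rewrite (ger0_norm (CKS0 L)); exact: CKS_O.
- apply: (@bigO_le _ _ _ (C * K1 * ((lam Q (p_hi Q))^-1 + M))) => L.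
  rewrite (le_trans _ (CKS_O L))//; have /andP[r0 rS] := regret L.
  (* Finiteness ensures that [fine] returns the regret itself and not its default value 0. *)
  have fin : regret2 Q U V D x f xs L \is a fin_num.
    by rewrite ge0_fin_numE// (le_lt_trans rS)// ltry.
  by rewrite ger0_norm ?fine_ge0// -lee_fin fineK.
Qed.
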